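(* Let $n\ge1$, let $B\subset\mathrm{SL}_n(\mathbb{C})$ be the Borel subgroup of upper triangular matrices and $\mathscr{X}_n$ the variety of complete quadrics in $\mathbb{P}^{n-1}$. Define polynomials $H_k(y)$ by $e^{y(x+x^2/2)}=\sum_{k\ge0}\frac{H_k(y)}{k!}x^k$. Then the number of $B$-orbits in $\mathscr{X}_n$ is $$b(\mathscr{X}_n)=a_{n,1}H_n(1)+a_{n,2}H_n(2)+\cdots+a_{n,n}H_n(n),\qquad a_{n,r}=\sum_{i=0}^{n-r}(-1)^i\binom{r+i}{r}.$$
   Context: The variety of complete quadrics $\mathscr{X}_n$ is the closure of the image of the map $[A]\mapsto([\Lambda^1 A],\dots,[\Lambda^{n-1}A])\in\prod_{i=1}^{n-1}\mathbb{P}(\Lambda^i(\mathrm{Sym}_n))$, $A$ ranging over invertible symmetric complex $n\times n$ matrices (equivalently the wonderful embedding of $\mathrm{SL}_n/\widetilde{\mathrm{SO}}_n$), with $\mathrm{SL}_n$ acting via $g\cdot A=(g^\top)^{-1}Ag^{-1}$. *)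

(* Defs.v *)
From HB Require Import structures.
From mathcomp Require Import all_boot all_order all_algebra.
From mathcomp.multinomials Require Import mpoly.
From mathcomp Require Import all_classical reals.
From mathcomp Require Import complex.

Set Implicit Arguments.
Unset Strict Implicit.
Unset Printing Implicit Defensive.

Import Order.TTheory GRing.Theory Num.Theory.
Local Open Scope ring_scope.

(* Increasing maps 'I_k -> 'I_n index the standard basis of the k-th exterior
   power of an n-dimensional space. *)
Section Incr.
Variables k n : nat.

Definition incr_map :=
  {f : {ffun 'I_k -> 'I_n} |
    [forall a : 'I_k, forall b : 'I_k, (a < b)%N ==> (f a < f b)%N]}.

Definition ext_dim : nat := #|{: incr_map}|.

Definition ext_idx (a : 'I_ext_dim) : 'I_k -> 'I_n := val (enum_val a).
End Incr.

(* The k-th compound matrix: the matrix of k x k minors of A, i.e. the matrix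
   of the k-th exterior power of A in the standard bases. *)
Definition extmx (C : comNzRingType) (k n : nat) (A : 'M[C]_n) :
    'M[C]_(ext_dim k n) :=
  \matrix_(a, b) \det (mxsub (ext_idx a) (ext_idx b) A).

Section ProjectiveSpace.
Variables (C : fieldType) (N : nat).

Definition symv : {vspace 'M[C]_N} := fixedSpace (linfun trmx).

Lemma symvP (X : 'M[C]_N) : reflect (X^T = X) (X \in symv).
Proof. by apply: (iffP fixedSpaceP); rewrite lfunE. Qed.

(* The projective space of symmetric N x N matrices; its points are lines. *)
Definition proj_sym :=
  {U : {vspace 'M[C]_N} | (\dim U == 1)%N && (U <= symv)%VS}.
End ProjectiveSpace.

Section CompleteQuadrics.
Variables (C : fieldType) (n : nat).

(* The ambient product of the P(Sym(Lambda^k C^n)), 1 <= k <= n - 1; the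
   factor of index i : 'I_n.-1 is the one with k = i.+1. *)
Definition ambient := forall i : 'I_n.-1, proj_sym C (ext_dim i.+1 n).

Definition represents (v : forall i : 'I_n.-1, 'M[C]_(ext_dim i.+1 n))
    (x : ambient) : Prop :=
  forall i, sval (x i) = <[v i]>%VS.

Definition coord_idx :=
  {i : 'I_n.-1 & ('I_(ext_dim i.+1 n) * 'I_(ext_dim i.+1 n))%type}.

Definition coord_val (v : forall i : 'I_n.-1, 'M[C]_(ext_dim i.+1 n))
    (c : 'I_#|{: coord_idx}|) : C :=
  let e := enum_val c in v (tag e) (tagged e).1 (tagged e).2.

(* Degree of a monomial in the variables of the i-th factor. *)
Definition factor_deg (i : 'I_n.-1) (m : 'X_{1..#|{: coord_idx}|}) : nat :=
  (\sum_(c < #|{: coord_idx}| | tag (enum_val c) == i) m c)%N.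

Fact factor_deg0 i : factor_deg i 0%MM = 0%N.
Proof. by rewrite /factor_deg big1 // => c _; rewrite mnm0E. Qed.

Fact factor_degD i :
  {morph factor_deg i : m1 m2 / (m1 + m2)%MM >-> (m1 + m2)%N}.
Proof.
move=> m1 m2; rewrite /factor_deg -big_split /=.
by apply: eq_bigr => c _; rewrite mnmDE.
Qed.

HB.instance Definition _ i :=
  isMeasure.Build #|{: coord_idx}| (factor_deg i)
    (factor_deg0 i) (factor_degD i).

Definition multihomogeneous (p : {mpoly C[#|{: coord_idx}|]}) : Prop :=
  exists d : 'I_n.-1 -> nat, forall i, p \is ishomog1 (d i) (factor_deg i).

Definition vanishes_at (p : {mpoly C[#|{: coord_idx}|]}) (x : ambient) : Prop :=
  forall v, represents v x -> p.@[coord_val v] = 0.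

Definition zariski_closure (S : set ambient) : set ambient :=
  [set x | forall p, multihomogeneous p ->
     (forall y, S y -> vanishes_at p y) -> vanishes_at p x]%classic.

Definition nondegenerate_quadrics : set ambient :=
  [set x | exists A : 'M[C]_n, [/\ A^T = A, A \in unitmx
     & represents (fun i => extmx i.+1 A) x]]%classic.

Definition complete_quadrics : set ambient :=
  zariski_closure nondegenerate_quadrics.

(* The action on symmetric forms of the k-th exterior power induced by
   g . A = (g^T)^-1 A g^-1. *)
Definition ext_act (k : nat) (g : 'M[C]_n) : 'End('M[C]_(ext_dim k n)) :=
  (linfun (mulmxr (extmx k (invmx g))) \o
   linfun (mulmx (extmx k (invmx g^T))))%VF.

Definition SL_borel : set 'M[C]_n :=
  [set g | \det g = 1 /\ forall i j : 'I_n, (j < i)%N -> g i j = 0]%classic.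

Definition borel_orbit (x : ambient) : set ambient :=
  [set y | exists2 g, SL_borel g &
     forall i : 'I_n.-1, sval (y i) = (ext_act i.+1 g @: sval (x i))%VS]%classic.

Definition borel_orbits : set (set ambient) :=
  [set borel_orbit x | x in complete_quadrics]%classic.
End CompleteQuadrics.

Arguments nondegenerate_quadrics C n : clear implicits.
Arguments complete_quadrics C n : clear implicits.
Arguments SL_borel C n : clear implicits.
Arguments borel_orbits C n : clear implicits.

(* The coefficient of x^k in the formal power series exp(F) over rat[y], for
   a polynomial F without constant term: only the terms F^m/m! with m <= k
   contribute, since x^m divides F^m. *)
Definition exp_coef (F : {poly {poly rat}}) (k : nat) : {poly rat} :=
  \sum_(m < k.+1) (m`!%:R)^-1 *: (F ^+ m)`_k.

(* The outer variable of {poly {poly rat}} is x, the inner one is y. *)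
Definition H_gen : {poly {poly rat}} :=
  ('X : {poly rat})%:P * ('X + (2%:R^-1)%:P%:P * 'X^2).

Definition Hpoly (k : nat) : {poly rat} := k`!%:R *: exp_coef H_gen k.

Definition coef_a (n r : nat) : rat :=
  \sum_(0 <= i < (n - r).+1) (-1) ^+ i * 'C(r + i, r)%:R.

(* Main.v *)
Require Import Defs.
From HB Require Import structures.
From mathcomp Require Import all_boot all_order all_algebra.
From mathcomp Require Import fingroup perm.
From mathcomp.multinomials Require Import mpoly.
From mathcomp Require Import all_classical reals.
From mathcomp Require Import complex.
From mathcomp Require Import zify ring.
Set Implicit Arguments.
Unset Strict Implicit.
Unset Printing Implicit Defensive.
Import Order.TTheory GRing.Theory Num.Theory.
Local Open Scope ring_scope.

(* Every B-orbit contains exactly one normal form: for a level function f on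
   {0, .., n-1} whose values form an initial segment and an involution s with
   f o s = f, the limit at t = 0 of the quadrics diag(t^f) P_s.  Its k-th component
   keeps the minors of P_s on the k-subsets of minimal f-weight.

   Existence.  For x in the closure, pairing the k-th component M with its conjugate
   shows that M does not vanish on all decomposable vectors, so after a generic change
   of basis all leading entries are nonzero.  On that chart A = U^T D U, and the
   entries of U and of the normalised minors of D (monomials in the d_(i+1)/d_i) are
   regular functions of the point, so x = G.(limit of a diagonal pencil).  Upper
   triangular column operations on G and an elimination by upper triangular
   congruences, respecting the levels, lead to a normal form.

   Uniqueness.  Compounds of upper triangular matrices are triangular for the order
   "equal, or smaller sum" on k-subsets, so the support of each component, which is a
   partial permutation, is an invariant, and it determines (f, s).

   Counting.  The pairs with f valued in a set of r colours are counted by H_n(r):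
   both satisfy h_(k+1) = r (h_k + k h_(k-1)).  Inclusion-exclusion over the image of f
   gives the coefficients a_(n,r). *)

(** * Compound matrices *)

(** The closure is given by equations, so no limit can be extracted from it: membership of x is
    exploited by finding multihomogeneous identities that hold at all scaled compounds of
    nondegenerate A. This dictates the coordinates. The pivots d_r have no meaning at the boundary,
    but the ratios z_m = d_(m+1)/d_m are regular on the chart, and identities among monomials in the
    z_m persist when some z_m vanish; the zeros of z cut the indices into levels.

    The pairing with the conjugate is needed because a nonzero form on an exterior power can vanish
    on every decomposable vector (Plücker relations), and only the closure condition rules this out.

    The function f need not be monotone. It is an ordered set partition: the block sizes give the
    boundary stratum, and the distribution of indices over the blocks gives the position of the flag
    of the degenerate quadric relative to the flag fixed by B. On each block s is the involution
    that classifies a nondegenerate quadric under triangular congruence. *)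

Section IndexSets.
Variables k n : nat.
Implicit Types (a b : 'I_(ext_dim k n)).

Lemma ext_idx_lt a (i j : 'I_k) : (i < j)%N -> (ext_idx a i < ext_idx a j)%N.
Proof.
move=> ij; have /forallP/(_ i)/forallP/(_ j)/implyP := valP (enum_val a).
exact.
Qed.

Lemma ext_idx_inj a : injective (ext_idx a).
Proof.
move=> i j eij; apply/val_inj; case: (ltngtP i j) => // /(ext_idx_lt a);
  by rewrite eij ltnn.
Qed.

Definition ext_set a : {set 'I_n} := [set ext_idx a i | i : 'I_k].

Lemma card_ext_set a : #|ext_set a| = k.
Proof. by rewrite card_imset ?card_ord //; apply: ext_idx_inj. Qed.

Lemma ext_idxP (f : 'I_k -> 'I_n) :
  (forall i j : 'I_k, (i < j)%N -> (f i < f j)%N) ->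
  exists a, ext_idx a =1 f.
Proof.
move=> fi.
have H : [forall a : 'I_k, forall b : 'I_k, (a < b)%N ==>
   ((finfun f : {ffun 'I_k -> 'I_n}) a < (finfun f : {ffun 'I_k -> 'I_n}) b)%N].
  by apply/'forall_'forall_implyP => i j; rewrite !ffunE; apply: fi.
pose u : incr_map k n := exist _ (finfun f) H.
by exists (enum_rank u) => i; rewrite /ext_idx enum_rankK ffunE.
Qed.

Lemma ext_idx_ext a b : ext_idx a =1 ext_idx b -> a = b.
Proof.
move=> eab; apply: enum_val_inj; apply: val_inj; apply/ffunP => i.
exact: eab.
Qed.

Lemma ext_set_inj : injective ext_set.
Proof.
move=> a b eab; apply: ext_idx_ext => i.
pose s (c : 'I_(ext_dim k n)) := map (fun i => val (ext_idx c i)) (enum 'I_k).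
have ss c : sorted ltn (s c).
  rewrite sorted_map.
  have : sorted ltn (map val (enum 'I_k)) by rewrite val_enum_ord iota_ltn_sorted.
  rewrite sorted_map; apply: sub_sorted => x y /=; exact: ext_idx_lt.
have mem c x : (x \in s c) = (x \in map val (enum (ext_set c))).
  apply/mapP/mapP => [[j _ ->]|[y]].
    by exists (ext_idx c j) => //; rewrite mem_enum imset_f.
  by rewrite mem_enum => /imsetP[j _ ->] ->; exists j; rewrite ?mem_enum.
have : s a = s b.
  by apply: (irr_sorted_eq ltn_trans ltnn) => // x; rewrite !mem eab.
move=> /(congr1 (fun s => nth 0%N s i)).
have sE c : nth 0%N (s c) i = ext_idx c i.
  by rewrite (nth_map i) ?nth_ord_enum ?size_enum_ord.
by rewrite !sE => /val_inj.
Qed.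

Lemma ext_setP (A : {set 'I_n}) : #|A| = k -> exists a, ext_set a = A.
Proof.
move=> cA.
have ex (i : 'I_k) : exists x : 'I_n, nth 0%N (map val (enum A)) i = x.
  have hi : (i < size (enum A))%N by rewrite -cardE cA.
  pose x := enum_val (cast_ord (esym cA) i).
  by exists x; rewrite (nth_map x) // -(enum_val_nth x (cast_ord (esym cA) i)).
have [f fE] := choice ex.
have sA : sorted ltn (map val (enum A)).
  have : sorted ltn (map val (enum 'I_n)) by rewrite val_enum_ord iota_ltn_sorted.
  apply: (subseq_sorted ltn_trans); apply: map_subseq.
  by rewrite enumT; apply: filter_subseq.
have szA : size (map val (enum A)) = k by rewrite size_map -cardE.
have [i j ij|a ea] := ext_idxP (f := f).
  rewrite -!fE; apply: (sorted_ltn_nth ltn_trans 0%N sA) => //;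
    by rewrite inE szA.
exists a; apply/eqP; rewrite eqEcard card_ext_set cA leqnn andbT.
apply/fintype.subsetP => x /imsetP[i _ ->]; rewrite ea.
have : (f i : nat) \in map val (enum A) by rewrite -fE mem_nth // szA.
by case/mapP => y yA /val_inj ->; move: yA; rewrite mem_enum.
Qed.

(** For a level function this is the exponent of t in a row of the compound of diag(t^f); for
    [f = val] it is the sum that orders the k-subsets. *)
Definition ext_wt (f : 'I_n -> nat) a : nat := (\sum_i f (ext_idx a i))%N.

Lemma ext_wtE f a : ext_wt f a = (\sum_(j in ext_set a) f j)%N.
Proof. by rewrite big_imset //= => i j _ _; apply: ext_idx_inj. Qed.

Lemma ext_set_id (hk : (k <= n)%N) : exists a, forall i, val (ext_idx a i) = i.
Proof.
have [|a ea] := @ext_idxP (widen_ord hk) _; first by [].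
by exists a => i; rewrite ea.
Qed.

Lemma ext_idx_ge a (i : 'I_k) : (i <= ext_idx a i)%N.
Proof.
case: i => i; elim: i => // i IH hi.
by apply: leq_ltn_trans (IH (ltnW hi)) _; apply: ext_idx_lt.
Qed.
End IndexSets.

Lemma det_neq0_perm (C : comNzRingType) k (A : 'M[C]_k) :
  \det A != 0 -> exists s : 'S_k, forall i, A i (s i) != 0.
Proof.
move=> dA; apply: contrapT => /forallNP H; case/eqP: dA.
apply: big1 => s _; have /existsNP[i /negP/negPn/eqP Ai] := H s.
by rewrite (bigD1 i) //= Ai mul0r mulr0.
Qed.

(** * The Cauchy-Binet formula *)

Section CauchyBinet.
Variable C : comNzRingType.

(** Multilinearity in the rows: each row of X Y is a combination of rows of Y, and f chooses one of
    them for every i. *)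
Lemma det_mulmx_rect k n (X : 'M[C]_(k, n)) (Y : 'M[C]_(n, k)) :
  \det (X *m Y) =
  \sum_(f : {ffun 'I_k -> 'I_n}) (\prod_i X i (f i)) * \det (rowsub f Y).
Proof.
rewrite /determinant.
under [RHS]eq_bigr => f _ do rewrite mulr_sumr.
rewrite exchange_big /=; apply: eq_bigr => s _.
under eq_bigr => i _ do rewrite mxE.
rewrite bigA_distr_bigA mulr_sumr; apply: eq_bigr => f _ /=.
rewrite big_split mulrCA; congr (_ * (_ * _)).
by apply: eq_bigr => i _; rewrite mxE.
Qed.

(** A non-injective f repeats a row and contributes nothing. An injective one is, uniquely, a
    permutation followed by an increasing map, and the sum over the permutations rebuilds the minor
    of X. *)
Lemma cauchy_binet k n (X : 'M[C]_(k, n)) (Y : 'M[C]_(n, k)) :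
  \det (X *m Y) = \sum_(a < ext_dim k n)
    \det (colsub (ext_idx a) X) * \det (rowsub (ext_idx a) Y).
Proof.
rewrite det_mulmx_rect (bigID (fun f : {ffun 'I_k -> 'I_n} => injectiveb f)) /=.
rewrite addrC big1 ?add0r; last first.
  move=> f /injectivePn[i [j ij fij]].
  rewrite (determinant_alternate ij) ?mulr0 // => l.
  by rewrite !mxE fij.
have ex (f : {ffun 'I_k -> 'I_n}) : exists a : option 'I_(ext_dim k n),
    injectiveb f -> omap (@ext_set k n) a = Some (f @: [set: 'I_k]).
  case: (boolP (injectiveb f)) => [/injectiveP fi|_]; last by exists None.
  have [|a ea] := @ext_setP k n (f @: [set: 'I_k]).
    by rewrite card_imset // cardsT card_ord.
  by exists (Some a) => _ /=; rewrite ea.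
have [p pE] := choice ex.
pose h a (s : 'S_k) : {ffun 'I_k -> 'I_n} := [ffun i => ext_idx a (s i)].
have h_inj a : injective (h a).
  move=> s t /ffunP est; apply/permP => i.
  by have := est i; rewrite !ffunE => /ext_idx_inj.
have hE (a : 'I_(ext_dim k n)) (f : {ffun 'I_k -> 'I_n}) :
    (f \in h a @: [set: 'S_k]) = injectiveb f && (p f == Some a).
  apply/imsetP/andP => [[s _ ->]|[fi /eqP pa]].
    have hi : injectiveb (h a s).
      by apply/injectiveP => i j; rewrite !ffunE => /ext_idx_inj/perm_inj.
    split => //; have := pE _ hi; case: (p _) => //= b [eb].
    apply/eqP; congr Some; apply: ext_set_inj; rewrite eb.
    apply/setP => x; apply/imsetP/imsetP => [[i _ ->]|[i _ ->]].
      by exists (s i); rewrite ?ffunE.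
    by exists ((s^-1)%g i); rewrite ?inE // ffunE permKV.
  have := pE _ fi; rewrite pa /= => -[ea]; move/injectiveP: fi => fi.
  have exi i : exists j, f i = ext_idx a j.
    have : f i \in ext_set a by rewrite ea imset_f.
    by case/imsetP => j _ ->; exists j.
  have [s sE] := choice exi.
  have si : injective s by move=> i j eij; apply: fi; rewrite !sE eij.
  by exists (perm si); rewrite ?inE //; apply/ffunP => i; rewrite ffunE permE sE.
transitivity (\sum_(a < ext_dim k n)
   \sum_(f in h a @: [set: 'S_k]) (\prod_i X i (f i)) * \det (rowsub f Y)).
  under [RHS]eq_bigr => a _ do rewrite (eq_bigl _ _ (hE a)).
  rewrite (exchange_big_dep (fun f : {ffun 'I_k -> 'I_n} => injectiveb f)) /=;
    last by move=> a f _ /andP[].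
  apply: eq_bigr => f fi; have := pE f fi.
  case: (p f) => //= a _; rewrite (big_pred1 a) // => b /=.
  by rewrite fi /= eq_sym; apply/eqP/eqP => [[]|->].
apply: eq_bigr => a _; rewrite big_imset /=; last by move=> s t _ _; apply: h_inj.
rewrite [\det (colsub _ _)]/determinant mulr_suml.
apply: eq_big => [s|s _]; first by rewrite inE.
have -> : rowsub (h a s) Y = row_perm s (rowsub (ext_idx a) Y).
  by apply/matrixP => i j; rewrite !mxE ffunE.
rewrite row_permE det_mulmx det_perm mulrA; congr (_ * _).
by rewrite mulrC; congr (_ * _); apply: eq_bigr => i _; rewrite mxE ffunE.
Qed.
End CauchyBinet.

Section Compound.
Variable C : comNzRingType.
Implicit Types (k n : nat).

Lemma extmxM k n (A B : 'M[C]_n) : extmx k (A *m B) = extmx k A *m extmx k B.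
Proof.
apply/matrixP => a b; rewrite !mxE.
have -> : mxsub (ext_idx a) (ext_idx b) (A *m B) =
    rowsub (ext_idx a) A *m colsub (ext_idx b) B.
  by apply/matrixP => i j; rewrite !mxE; apply: eq_bigr => l _; rewrite !mxE.
rewrite cauchy_binet; apply: eq_bigr => c _; rewrite !mxE.
by congr (_ * _); congr (\det _); apply/matrixP => i j; rewrite !mxE.
Qed.

Lemma extmx_tr k n (A : 'M[C]_n) : extmx k A^T = (extmx k A)^T.
Proof.
by apply/matrixP => a b; rewrite !mxE -det_tr; congr (\det _);
  apply/matrixP => i j; rewrite !mxE.
Qed.

Lemma extmxZ k n (c : C) (A : 'M[C]_n) : extmx k (c *: A) = c ^+ k *: extmx k A.
Proof.
apply/matrixP => a b; rewrite !mxE -detZ; congr (\det _).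
by apply/matrixP => i j; rewrite !mxE.
Qed.

(** A nonzero Leibniz term matches rows with columns through nonzero entries; the hypothesis is
    summed along this matching. *)
Lemma ext_wt_le k n (f f' : 'I_n -> nat) (X : 'M[C]_n) a b :
  (forall i j, X i j != 0 -> (f j <= f' i)%N) ->
  extmx k X a b != 0 -> (ext_wt f b <= ext_wt f' a)%N.
Proof.
move=> hX; rewrite mxE => /det_neq0_perm[s hs].
rewrite /ext_wt (reindex_inj (@perm_inj _ s)) /=.
by apply: leq_sum => i _; apply: hX; have := hs i; rewrite mxE.
Qed.

(** A nonzero Leibniz term using an entry with [f j < f' i] would make the weight of b strictly
    smaller than that of a, so only level-preserving entries contribute. *)
Lemma ext_wt_part k n (f f' : 'I_n -> nat) (X : 'M[C]_n) a b :
  (forall i j, X i j != 0 -> (f j <= f' i)%N) ->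
  (ext_wt f' a <= ext_wt f b)%N ->
  extmx k X a b =
  extmx k (\matrix_(i, j) if f j == f' i then X i j else 0) a b.
Proof.
move=> hX hw; rewrite !mxE /determinant; apply: eq_bigr => s _; congr (_ * _).
have [/forallP hs|] := boolP [forall i, f (ext_idx b (s i)) == f' (ext_idx a i)].
  by apply: eq_bigr => i _; rewrite !mxE hs.
rewrite negb_forall => /existsP[i0 hi0].
rewrite [RHS](bigD1 i0) //= !mxE (negPf hi0) mul0r.
apply/eqP/negPn/negP => nz.
have hi i : (f (ext_idx b (s i)) <= f' (ext_idx a i))%N.
  by apply: hX; move: nz; rewrite (bigD1 i) //= !mxE; apply: contraNneq => ->; rewrite mul0r.
move: hw; rewrite /ext_wt [in X in (_ <= X)%N](reindex_inj (@perm_inj _ s)) /=.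
rewrite (bigD1 i0) //= [in X in (_ <= X)%N](bigD1 i0) //= leqNgt => /negP; apply.
rewrite -addSn leq_add //; first by rewrite ltn_neqAle hi0 hi.
by apply: leq_sum => i _.
Qed.

(** [ext_wt_le] for the transpose and [val] compares the sums; in the case of equality only diagonal
    entries contribute, so the two sets coincide. *)
Lemma extmx_upper_neq0 k n (X : 'M[C]_n) (a b : 'I_(ext_dim k n)) :
  (forall i j : 'I_n, (j < i)%N -> X i j = 0) -> extmx k X a b != 0 ->
  a = b \/ (ext_wt val a < ext_wt val b)%N.
Proof.
move=> hX nz.
have hX' (i j : 'I_n) : X^T i j != 0 -> (j <= i)%N.
  by rewrite mxE; apply: contraNT; rewrite -ltnNge => /hX ->.
have nz' : extmx k X^T b a != 0 by rewrite extmx_tr mxE.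
have := ext_wt_le hX' nz'; rewrite leq_eqVlt => /orP[/eqP e|]; last by right.
left; move: nz'; rewrite (ext_wt_part hX') ?e // mxE => /det_neq0_perm[s hs].
have {}hs i : ext_idx b i = ext_idx a (s i).
  apply: val_inj; have := hs i; rewrite !mxE.
  case: ifP => [/eqP ei _|_]; first exact: (esym ei).
  by rewrite eqxx.
apply: ext_set_inj; apply/setP => x; apply/imsetP/imsetP => -[i _ ->].
  by exists ((s^-1)%g i); rewrite // hs permKV.
by exists (s i).
Qed.

Lemma extmx_upper_diag k n (X : 'M[C]_n) (a : 'I_(ext_dim k n)) :
  (forall i j : 'I_n, (j < i)%N -> X i j = 0) ->
  extmx k X a a = \prod_i X (ext_idx a i) (ext_idx a i).
Proof.
move=> hX; rewrite mxE -det_tr det_trig.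
  by apply: eq_bigr => i _; rewrite !mxE.
apply/is_trig_mxP => i j ij; rewrite !mxE; apply: hX; exact: ext_idx_lt.
Qed.

Lemma extmx_diag k n (d : 'rV[C]_n) :
  extmx k (diag_mx d) = diag_mx (\row_a \prod_i d 0 (ext_idx a i)).
Proof.
apply/matrixP => a b.
have hU (i j : 'I_n) : (j < i)%N -> diag_mx d i j = 0.
  by move=> ij; rewrite mxE -val_eqE gtn_eqF.
have hL (i j : 'I_n) : (j < i)%N -> (diag_mx d)^T i j = 0.
  by move=> ij; rewrite tr_diag_mx hU.
rewrite [in RHS]mxE [in RHS]mxE; case: eqVneq => [<-|nab] /=.
  by rewrite extmx_upper_diag // mulr1n; apply: eq_bigr => i _; rewrite mxE eqxx.
rewrite mulr0n; apply/eqP/negPn/negP => nz.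
have [eab|lt1] := extmx_upper_neq0 hU nz; first by rewrite eab eqxx in nab.
have nz' : extmx k (diag_mx d)^T b a != 0 by rewrite extmx_tr mxE.
have [eab|lt2] := extmx_upper_neq0 hL nz'; first by rewrite eab eqxx in nab.
by have := ltn_trans lt1 lt2; rewrite ltnn.
Qed.

Lemma extmx1 k n : extmx k 1%:M = 1%:M :> 'M[C]_(ext_dim k n).
Proof.
rewrite -!diag_const_mx extmx_diag; congr diag_mx; apply/rowP => a.
by rewrite !mxE big1 // => i _; rewrite mxE.
Qed.

Lemma extmx_map (D : comNzRingType) (h : {rmorphism C -> D}) k n (A : 'M[C]_n) :
  extmx k (map_mx h A) = map_mx h (extmx k A).
Proof.
apply/matrixP => a b; rewrite !mxE -det_map_mx; congr (\det _).
by apply/matrixP => i j; rewrite !mxE.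
Qed.
End Compound.

Lemma extmx_unit (C : comUnitRingType) k n (A : 'M[C]_n) :
  A \in unitmx -> extmx k A \in unitmx.
Proof.
move=> uA; have := extmx1 C k n; rewrite -(mulmxV uA) extmxM.
by move/mulmx1_unit => [].
Qed.

(** * Triangular congruence *)

Definition upper_mx (C : nzRingType) n (b : 'M[C]_n) : Prop :=
  forall i j : 'I_n, (j < i)%N -> b i j = 0.

Definition level_mx (C : nzRingType) n (f : 'I_n -> nat) (b : 'M[C]_n) : Prop :=
  forall i j, b i j != 0 -> f i = f j.

Lemma upper_mxM (C : nzRingType) n (a b : 'M[C]_n) :
  upper_mx a -> upper_mx b -> upper_mx (a *m b).
Proof.
move=> ha hb i j ij; rewrite mxE big1 // => l _.
have [li|il] := ltnP l i; first by rewrite ha ?mul0r.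
by rewrite [b _ _]hb ?mulr0 // (leq_trans ij).
Qed.

Lemma upper_mx1 (C : nzRingType) n : upper_mx (1%:M : 'M[C]_n).
Proof. by move=> i j ij; rewrite mxE -val_eqE gtn_eqF. Qed.

Lemma level_mxM (C : nzRingType) n (f : 'I_n -> nat) (a b : 'M[C]_n) :
  level_mx f a -> level_mx f b -> level_mx f (a *m b).
Proof.
move=> ha hb i j; rewrite mxE; apply: contra_neq_eq => fij; apply: big1 => l _.
have [->|/ha fil] := eqVneq (a i l) 0; first by rewrite mul0r.
have [->|/hb flj] := eqVneq (b l j) 0; first by rewrite mulr0.
by rewrite fil flj eqxx in fij.
Qed.

Lemma level_mx1 (C : nzRingType) n f : level_mx f (1%:M : 'M[C]_n).
Proof. by move=> i j; rewrite mxE; case: (eqVneq i j) => [->//|_]; rewrite eqxx. Qed.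

Lemma level_mx_tr (C : nzRingType) n f (a : 'M[C]_n) :
  level_mx f a -> level_mx f a^T.
Proof. by move=> ha i j; rewrite mxE => /ha ->. Qed.

Lemma upper_det (C : comNzRingType) n (b : 'M[C]_n) :
  upper_mx b -> \det b = \prod_i b i i.
Proof.
move=> hb; rewrite -det_tr det_trig; first by apply: eq_bigr => i _; rewrite mxE.
by apply/is_trig_mxP => i j ij; rewrite mxE hb.
Qed.

Lemma upper_unitP (C : fieldType) n (b : 'M[C]_n) :
  upper_mx b -> reflect (forall i, b i i != 0) (b \in unitmx).
Proof.
move=> hb; rewrite unitmxE unitfE upper_det //.
by apply: (iffP (prodf_neq0 _ _)) => H i *; apply: H.
Qed.

Lemma upper_inv (C : fieldType) n (b : 'M[C]_n) :
  b \in unitmx -> upper_mx b -> upper_mx (invmx b).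
Proof.
move=> ub hb; have /(upper_unitP hb) bd := ub.
(* Downward induction on the row: entry (i, j) of [b *m invmx b] involves only rows from i on of the
   inverse. *)
suff H (m : nat) : forall i j : 'I_n, (j < i)%N -> (n - i <= m)%N -> invmx b i j = 0.
  by move=> i j ij; apply: (H n) => //; lia.
elim: m => [|m IH] i j ij im; first by have := ltn_ord i; lia.
have /matrixP/(_ i j) := mulmxV ub; rewrite !mxE -val_eqE gtn_eqF //=.
rewrite (bigD1 i) //= big1 ?addr0 => [/eqP|l li].
  by rewrite mulf_eq0 (negPf (bd _)) /= => /eqP.
have [lti|il|/val_inj el] := ltngtP l i; last by rewrite el eqxx in li.
  by rewrite hb ?mul0r.
by rewrite IH ?mulr0 // ?(ltn_trans ij) //; have := ltn_ord l; lia.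
Qed.

Section Congruence.
Variables (C : numClosedFieldType) (n : nat) (f : 'I_n -> nat).
Implicit Types (h b : 'M[C]_n).

(** These are moves available on the form [A] inside [lead k f A], by [lead_mul_level]. *)
Definition bcong h h' := exists b, [/\ upper_mx b, b \in unitmx, level_mx f b
  & h' = b^T *m h *m b].

Lemma bcong_refl h : bcong h h.
Proof.
exists 1%:M; split; rewrite ?unitmx1 ?trmx1 ?mul1mx ?mulmx1 //.
  exact: upper_mx1.
exact: level_mx1.
Qed.

Lemma bcong_trans h1 h2 h3 : bcong h1 h2 -> bcong h2 h3 -> bcong h1 h3.
Proof.
move=> [b [ub Ub lb ->]] [c [uc Uc lc ->]]; exists (b *m c); split.
- exact: upper_mxM.
- by rewrite unitmx_mul Ub.
- exact: level_mxM.
- by rewrite trmx_mul !mulmxA.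
Qed.

Lemma bcong_sym_mx h h' : bcong h h' -> h^T = h -> h'^T = h'.
Proof. by move=> [b [_ _ _ ->]] hs; rewrite !trmx_mul trmxK hs mulmxA. Qed.

Lemma bcong_unit h h' : bcong h h' -> h \in unitmx -> h' \in unitmx.
Proof. by move=> [b [_ Ub _ ->]] hu; rewrite !unitmx_mul unitmx_tr Ub hu. Qed.

Lemma bcong_level h h' : bcong h h' -> level_mx f h -> level_mx f h'.
Proof.
move=> [b [_ _ lb ->]] hl; apply: level_mxM => //; apply: level_mxM => //.
exact: level_mx_tr.
Qed.

(** One symmetric elimination step: b subtracts [beta j] times column r from column j, and its
    transpose does the same to the rows. The side conditions make b unitriangular and compatible
    with the levels. *)
Lemma bcong_transvection h (r : 'I_n) (beta : 'I_n -> C) :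
  (forall j, beta j != 0 -> (r < j)%N /\ f r = f j) ->
  bcong h (\matrix_(i, j) (h i j - beta i * h r j - h i r * beta j
                           + beta i * beta j * h r r)).
Proof.
move=> hb; pose b : 'M[C]_n := \matrix_(i, j) ((i == j)%:R - (i == r)%:R * beta j).
have b0 (j : 'I_n) : (j <= r)%N -> beta j = 0.
  by move=> jr; apply/eqP; apply: contraTT jr => /hb[]; rewrite -ltnNge.
have ub : upper_mx b.
  move=> i j ij; rewrite mxE -val_eqE gtn_eqF // sub0r.
  case: (eqVneq i r) => [ir|_]; last by rewrite mul0r oppr0.
  by rewrite b0 ?mulr0 ?oppr0 // -ir ltnW.
exists b; split => //.
- apply/upper_unitP => // i; rewrite mxE eqxx; case: (eqVneq i r) => [->|_].
    by rewrite b0 // mulr0 subr0 oner_neq0.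
  by rewrite mul0r subr0 oner_neq0.
- move=> i j; rewrite mxE; case: (eqVneq i j) => [->//|_]; rewrite sub0r oppr_eq0.
  case: (eqVneq i r) => [->|_]; last by rewrite mul0r eqxx.
  by rewrite mul1r => /hb[].
have mulb (X : 'M[C]_n) i j : (X *m b) i j = X i j - X i r * beta j.
  rewrite mxE; under eq_bigr => l _ do rewrite mxE mulrBr.
  rewrite sumrB (bigD1 j) //= eqxx mulr1 big1 ?addr0; last first.
    by move=> l /negPf ->; rewrite mulr0.
  rewrite (bigD1 r) //= eqxx mul1r big1 ?addr0 // => l /negPf ->.
  by rewrite mul0r mulr0.
apply/matrixP => i j; rewrite mxE mulb.
have E l : (b^T *m h) i l = h i l - beta i * h r l.
  rewrite -[b^T *m h]trmxK trmx_mul trmxK mxE mulb !mxE; ring.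
rewrite !E; ring.
Qed.

(** For symmetric [h] the index i is finished: it splits off alone ([c = i]) or as half of a
    hyperbolic pair. *)
Definition settled h i := [exists c, [forall j,
  ((h i j != 0) == (j == c)) && ((h c j != 0) == (j == i))]].

Lemma settledP h i : reflect (exists c, forall j,
   (h i j != 0) = (j == c) /\ (h c j != 0) = (j == i)) (settled h i).
Proof.
apply: (iffP existsP) => -[c H]; exists c.
  by move=> j; move/forallP/(_ j)/andP: H => [/eqP -> /eqP ->].
by apply/forallP => j; have [-> ->] := H j; rewrite !eqxx.
Qed.

Lemma settled_neq0 h i j : settled h i -> h i j != 0 -> settled h j.
Proof.
move=> /settledP[c H]; rewrite (H j).1 => /eqP ->.
by apply/settledP; exists i => l; split; rewrite ?(H l).1 ?(H l).2.
Qed.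

(** A settled row vanishes at every unsettled column, so neither the pivot row nor [beta] reaches
    it. *)
Lemma settled_transvection h (r : 'I_n) (beta : 'I_n -> C) i : h^T = h ->
  ~~ settled h r -> (forall j, beta j != 0 -> ~~ settled h j) -> settled h i ->
  settled (\matrix_(i, j) (h i j - beta i * h r j - h i r * beta j
                           + beta i * beta j * h r r)) i.
Proof.
move=> hs nr hb si.
have H l j : settled h l -> (\matrix_(i, j) (h i j - beta i * h r j - h i r * beta j
                           + beta i * beta j * h r r)) l j = h l j.
  move=> sl; rewrite mxE.
  have -> : beta l = 0 by apply/eqP; apply: contraTT sl => /hb.
  have -> : h l r = 0 by apply/eqP; apply: contraNT nr; apply: settled_neq0.
  ring.
have /settledP[c hc] := si; apply/settledP; exists c => j.
have sc : settled h c by apply: settled_neq0 si _; rewrite (hc c).1 eqxx.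
by rewrite !H.
Qed.

(** Induction on the number of unsettled indices. The pivot row is the least unsettled r, and c is
    its first nonzero column: a diagonal pivot clears the row at once, otherwise r and c become a
    hyperbolic pair. *)
Lemma bcong_settle h : h^T = h -> h \in unitmx -> level_mx f h ->
  exists2 h', bcong h h' & forall i, settled h' i.
Proof.
have [m] := ubnP #|[set i | ~~ settled h i]|.
elim: m h => // m IH h; rewrite ltnS => hm hs hu hl.
have [/forallP all|] := boolP [forall i, settled h i].
  by exists h => //; apply: bcong_refl.
rewrite negb_forall => /existsP[r0 hr0].
(* Minimality of r places all columns to be cleared to its right, which keeps the operations upper
   triangular. *)
have [r hr rmin] := @arg_minnP _ r0 (fun i => ~~ settled h i) val hr0.
have nsr j : h r j != 0 -> ~~ settled h j.
  move=> hrj; apply: contra hr => /settled_neq0; apply.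
  by rewrite -hs mxE.
have rle j : h r j != 0 -> (r <= j)%N by move/nsr/rmin.
suff [h' hh' [hr' keep]] : exists2 h', bcong h h' &
    settled h' r /\ forall i, settled h i -> settled h' i.
  have [||||h2 h2c h2s] := IH h'.
  - apply: leq_trans hm; apply: proper_card; apply/properP; split.
      by apply/fintype.subsetP => i; rewrite !inE; apply: contra; apply: keep.
    by exists r; rewrite !inE ?hr' // hr.
  - exact: bcong_sym_mx hh' hs.
  - exact: bcong_unit hh' hu.
  - exact: bcong_level hh' hl.
  by exists h2 => //; apply: bcong_trans hh' h2c.
have ex0 : exists j, h r j != 0.
  apply: contrapT => /forallNP H.
  have : row r h = 0 by apply/rowP => j; rewrite !mxE; apply/eqP/negPn/negP/H.
  move/(congr1 (mulmx^~ (invmx h))); rewrite -row_mul mulmxV // mul0mx.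
  by move=> /rowP/(_ r); rewrite !mxE eqxx => /eqP; rewrite oner_eq0.
have [c0 hc0] := ex0.
have [c hc cmin] := @arg_minnP _ c0 (fun j => h r j != 0) val hc0.
have [erc|nrc] := eqVneq c r.
  subst c; pose beta j := if j == r then 0 else h r j / h r r.
  have hbeta j : beta j != 0 -> h r j != 0 /\ j != r.
    rewrite /beta; case: (eqVneq j r) => [->|_]; first by rewrite eqxx.
    by rewrite mulf_eq0 negb_or => /andP[].
  exists (\matrix_(i, j) (h i j - beta i * h r j - h i r * beta j
                           + beta i * beta j * h r r)).
    apply: bcong_transvection => j /hbeta[hrj jr]; split; last exact: hl.
    by rewrite ltn_neqAle eq_sym jr rle.
  split; last first.
    by move=> i; apply: settled_transvection => // j /hbeta[/nsr].
  apply/settledP; exists r => j; suff E : (\matrix_(i, j) (h i j - beta i * h r j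
      - h i r * beta j + beta i * beta j * h r r)) r j = if j == r then h r r else 0.
    by rewrite E; case: (eqVneq j r); rewrite ?hc ?eqxx.
  rewrite mxE {1 3}/beta eqxx /beta; case: (eqVneq j r) => [->|_].
    by ring.
  by field.
have hrr : h r r = 0.
  apply/eqP/negPn/negP => /cmin; rewrite leqNgt => /negP; apply.
  by rewrite ltn_neqAle eq_sym nrc rle.
pose a := h r c; have ha : a != 0 by [].
have rc : (r < c)%N by rewrite ltn_neqAle eq_sym nrc rle.
(* Column c clears the later columns of row r; since [h r r = 0], only the entry at c is left in
   that row. *)
pose beta j := if j == c then 0 else h r j / a.
have hbeta j : beta j != 0 -> h r j != 0 /\ j != c.
  rewrite /beta; case: (eqVneq j c) => [->|_]; first by rewrite eqxx.
  by rewrite mulf_eq0 negb_or => /andP[].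
set h1 : 'M[C]_n := \matrix_(i, j) (h i j - beta i * h c j - h i c * beta j
                           + beta i * beta j * h c c).
have hh1 : bcong h h1.
  apply: bcong_transvection => j /hbeta[hrj jc]; split.
    by rewrite ltn_neqAle eq_sym jc cmin.
  by rewrite -(hl _ _ hc) (hl _ _ hrj).
have h1s := bcong_sym_mx hh1 hs.
have keep1 i : settled h i -> settled h1 i.
  by apply: settled_transvection => //; [apply: nsr|move=> j /hbeta[/nsr]].
have h1r j : h1 r j = if j == c then a else 0.
  rewrite mxE {1 3}/beta eq_sym (negPf nrc) hrr mul0r !mul0r addr0 subr0.
  rewrite /beta /a; case: (eqVneq j c) => [->|_]; first by ring.
  by field.
have h1l := bcong_level hh1 hl.
have [sr|hr1] := boolP (settled h1 r); first by exists h1.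
have nsr1 j : h1 c j != 0 -> ~~ settled h1 j.
  move=> hcj; apply: contra hr1 => sj.
  have sc : settled h1 c by apply: (settled_neq0 sj); rewrite -h1s mxE.
  by apply: (settled_neq0 sc); rewrite -h1s mxE h1r eqxx.
have h1rle j : h1 c j != 0 -> (r <= j)%N.
  move=> /nsr1 hj; apply: rmin; apply: contra hj; exact: keep1.
(* Row c is cleared with row r, whose only entry is a. The entry (c, c) is hit once by the row and
   once by the column operation, whence the factor 2. *)
pose gamma j := if j == r then 0 else
   if j == c then h1 c c / (2%:R * a) else h1 c j / a.
have hgamma j : gamma j != 0 -> h1 c j != 0 /\ j != r.
  rewrite /gamma; case: (eqVneq j r) => [->|_]; first by rewrite eqxx.
  by case: (eqVneq j c) => [->|_]; rewrite mulf_eq0 negb_or => /andP[].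
exists (\matrix_(i, j) (h1 i j - gamma i * h1 r j - h1 i r * gamma j
                           + gamma i * gamma j * h1 r r)).
  apply: bcong_trans hh1 _; apply: bcong_transvection => j /hgamma[hcj jr].
  split; first by rewrite ltn_neqAle eq_sym jr h1rle.
  by rewrite -(h1l _ _ hcj); apply: h1l; rewrite h1r eqxx.
split; last first.
  move=> i /keep1; apply: settled_transvection => // j /hgamma[] /nsr1; exact.
have g2 : 2%:R != 0 :> C by rewrite pnatr_eq0.
have h1cr : h1 c r = a by rewrite -h1s mxE h1r eqxx.
apply/settledP; exists c => j; split; rewrite mxE.
  rewrite /gamma eqxx !h1r [r == c]eq_sym (negPf nrc) !mul0r subr0 addr0 subr0.
  by case: (eqVneq j c); rewrite ?ha ?eqxx.
rewrite !h1r h1cr [r == c]eq_sym (negPf nrc) mulr0 addr0 /gamma (negPf nrc) eqxx.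
case: (eqVneq j r) => [->|_].
  by rewrite [r == c]eq_sym (negPf nrc) !mulr0 !subr0 h1cr ha.
case: (eqVneq j c) => [->|_]; last first.
  by rewrite mulr0 subr0 mulrCA divff // mulr1 subrr eqxx.
apply/negbTE/negPn/eqP; field; by rewrite ha.
Qed.

(** A settled form is supported on the graph of an involution, and a diagonal congruence turns its
    entries into 1. *)
Lemma sym_borel_normal h : h^T = h -> h \in unitmx -> level_mx f h ->
  exists s : 'S_n, [/\ forall i, s (s i) = i, forall i, f (s i) = f i
    & bcong h (perm_mx s)].
Proof.
move=> hs hu hl; have [h1 hh1 sett] := bcong_settle hs hu hl.
have h1s := bcong_sym_mx hh1 hs; have h1l := bcong_level hh1 hl.
have ex i : exists c, forall j,
   (h1 i j != 0) = (j == c) /\ (h1 c j != 0) = (j == i) by apply/settledP.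
have [s0 s0E] := choice ex.
have ss i : s0 (s0 i) = i.
  have := (s0E (s0 i) i).1; rewrite (s0E i i).2 eqxx => /esym/eqP; exact: esym.
have si : injective s0 := can_inj ss.
exists (perm si); split.
- by move=> i; rewrite !permE ss.
- by move=> i; rewrite permE; apply/esym/h1l; rewrite (s0E i _).1 eqxx.
apply: bcong_trans hh1 _.
(* Symmetry of [h1] gives [d (s0 i) = d i], so the two factors scaling an entry multiply to its
   inverse. *)
pose d i := (sqrtC (h1 i (s0 i)))^-1.
have nz i : h1 i (s0 i) != 0 by rewrite (s0E i _).1.
exists (diag_mx (\row_i d i)).
have ud : upper_mx (diag_mx (\row_i d i)).
  by move=> i j ij; rewrite !mxE -val_eqE gtn_eqF.
split => //.
- apply/upper_unitP => // i; rewrite !mxE eqxx mulr1n invr_eq0 sqrtC_eq0; exact: nz.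
- move=> i j; rewrite !mxE; case: (eqVneq i j) => [->//|_]; by rewrite mulr0n eqxx.
rewrite tr_diag_mx; apply/matrixP => i j; rewrite mul_mx_diag mul_diag_mx !mxE permE.
have [<-|ne] := eqVneq (s0 i) j; last first.
  have -> : h1 i j = 0.
    by apply/eqP/negPn; rewrite (s0E i j).1 eq_sym.
  by rewrite mulr0 mul0r.
have -> : d (s0 i) = d i by rewrite /d ss -[in RHS]h1s mxE.
by rewrite mulrAC -expr2 /d exprVn sqrtCK mulVf.
Qed.
End Congruence.

Lemma column_tops (C : fieldType) n (g : 'M[C]_n) : g \in unitmx ->
  exists b (rho : 'I_n -> 'I_n), [/\ upper_mx b, b \in unitmx, injective rho,
    forall j, (g *m b) (rho j) j != 0
    & forall i j, (g *m b) i j != 0 -> (rho j <= i)%N].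
Proof.
(* Column j of g b is taken in col_j + span(col_l, l < j) with its first nonzero entry
   as low as possible: two equal tops could be cancelled. *)
move=> gu.
pose ok (j : 'I_n) (u : 'cV[C]_n) := u j 0 = 1 /\ forall l : 'I_n, (j < l)%N -> u l 0 = 0.
pose P j t := exists2 u, ok j u & forall i : 'I_n, (i < t)%N -> (g *m u) i 0 = 0.
have ex j : exists v : 'cV[C]_n * 'I_n, [/\ ok j v.1, (g *m v.1) v.2 0 != 0,
   forall i : 'I_n, (i < v.2)%N -> (g *m v.1) i 0 = 0 & ~ P j v.2.+1].
  have P0 : exists t, `[< P j t >].
    exists 0%N; apply/asboolP; exists (delta_mx j 0) => //.
    split; first by rewrite mxE !eqxx.
    by move=> l jl; rewrite mxE -val_eqE gtn_eqF.
  have Pn t : `[< P j t >] -> (t <= n)%N.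
    move=> /asboolP[u [uj _] hu]; rewrite leqNgt; apply/negP => nt.
    have : g *m u = 0.
      by apply/colP => i; rewrite hu ?mxE // (ltn_trans (ltn_ord i)).
    move/(congr1 (mulmx (invmx g))); rewrite mulKmx // mulmx0 => u0.
    by move: uj; rewrite u0 mxE => /esym/eqP; rewrite oner_eq0.
  have [t /asboolP[u ou hu] tmax] := ex_maxnP P0 Pn.
  have nP : ~ P j t.+1 by move/asboolP/tmax; rewrite ltnn.
  have [i [it gi]] : exists i : 'I_n, val i = t /\ (g *m u) i 0 != 0.
    apply: contrapT => H; apply: nP; exists u => // i.
    rewrite ltnS leq_eqVlt => /orP[/eqP it|]; last exact: hu.
    by apply/eqP/negPn/negP => gi; apply: H; exists i.
  by exists (u, i); rewrite /= it; split.
have [v vE] := choice ex.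
pose b : 'M[C]_n := \matrix_(i, j) (v j).1 i 0.
have gb i j : (g *m b) i j = (g *m (v j).1) i 0.
  by rewrite !mxE; apply: eq_bigr => l _; rewrite mxE.
have ub : upper_mx b by move=> i j ij; rewrite mxE; case: (vE j) => [[_ ->]].
exists b, (fun j => (v j).2); split => //.
- apply/upper_unitP => // i; rewrite mxE; case: (vE i) => [[-> _] _ _ _].
  exact: oner_neq0.
- suff H (j j' : 'I_n) : (j' < j)%N -> (v j).2 <> (v j').2.
    by move=> j j' e; apply: val_inj; case: (ltngtP j j') => // /H[].
  move=> jj e; have [[uj hu] gj hj []] := vE j; have [[uj' hu'] gj' hj' _] := vE j'.
  have subE (X Y : 'cV[C]_n) c i : (X - c *: Y) i 0 = X i 0 - c * Y i 0.
    by rewrite !mxE.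
  pose c := (g *m (v j).1) (v j).2 0 / (g *m (v j').1) (v j').2 0.
  exists ((v j).1 - c *: (v j').1).
    split; first by rewrite !mxE uj hu' // mulr0 subr0.
    by move=> l jl; rewrite !mxE hu // hu' ?(ltn_trans jj) // mulr0 subr0.
  move=> i; rewrite mulmxBr -scalemxAr ltnS leq_eqVlt => /orP[/eqP it|it].
    have -> : i = (v j).2 by apply: val_inj.
    by rewrite subE /c -[in X in _ / X]e divfK ?subrr // e.
  by rewrite subE hj // hj' -?e // mulr0 subr0.
- by move=> j; rewrite gb; case: (vE j).
move=> i j; rewrite gb leqNgt; apply: contra => ij.
by case: (vE j) => _ _ ->.
Qed.

(** * Minimal weights *)

Section MinimalSets.
Variables (k n : nat).
Implicit Types (f : 'I_n -> nat) (a b : 'I_(ext_dim k n)).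

Definition wmin f a := [forall b : 'I_(ext_dim k n), (ext_wt f a <= ext_wt f b)%N].

Lemma wminP f a : reflect (forall b, (ext_wt f a <= ext_wt f b)%N) (wmin f a).
Proof. exact: forallP. Qed.

Lemma ext_wt_comp f (rho : 'I_n -> 'I_n) a : injective rho ->
  exists b, ext_wt f b = ext_wt (f \o rho) a.
Proof.
move=> rI; have [|b eb] := @ext_setP k n (rho @: ext_set a).
  by rewrite card_imset // card_ext_set.
by exists b; rewrite !ext_wtE eb big_imset //= => i j _ _; apply: rI.
Qed.

Lemma wmin_exists f a : exists b, wmin f b.
Proof.
have [b _ bm] := @arg_minnP _ a xpredT (ext_wt f) isT.
by exists b; apply/wminP => c; apply: bm.
Qed.

Lemma wmin_exchange f a i j :
  wmin f a -> i \in ext_set a -> j \notin ext_set a -> (f i <= f j)%N.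
Proof.
move=> /wminP ma ia ja.
have [|b eb] := @ext_setP k n (j |: (ext_set a :\ i)).
  have := cardsD1 i (ext_set a).
  by rewrite cardsU1 !inE (negPf ja) andbF ia card_ext_set => <-.
have := ma b; rewrite !ext_wtE eb (big_setD1 i) //= big_setU1 /=.
  by rewrite leq_add2r.
by rewrite !inE (negPf ja) andbF.
Qed.

(** The sets [a] and [b] are compared on their two differences, which have the same size and lie on
    either side of the threshold v. *)
Lemma exchange_wmin f a (v : nat) :
  (forall i, i \in ext_set a -> (f i <= v)%N) ->
  (forall j, j \notin ext_set a -> (v <= f j)%N) -> wmin f a.
Proof.
move=> h1 h2; apply/wminP => b; rewrite !ext_wtE.
rewrite (big_setID (ext_set b)) [in X in (_ <= X)%N](big_setID (ext_set a)) /=.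
rewrite [ext_set b :&: _]finset.setIC leq_add2l.
have cD : #|ext_set a :\: ext_set b| = #|ext_set b :\: ext_set a|.
  by rewrite !cardsD !card_ext_set finset.setIC.
apply: (@leq_trans (#|ext_set a :\: ext_set b| * v)).
  by rewrite -sum_nat_const; apply: leq_sum => i; rewrite !inE => /andP[_ /h1].
rewrite cD -sum_nat_const; apply: leq_sum => i; rewrite !inE => /andP[/h2 h _].
exact: h.
Qed.
End MinimalSets.

(** * Leading forms under filtered changes of basis *)

Section Lead.
Variables (C : fieldType) (n : nat).
Implicit Types (f : 'I_n -> nat) (A X : 'M[C]_n).

(* The coefficient of lowest t-order of the k-th compound of diag(t^f) A, when
   A preserves the levels of f. *)
Definition lead k f A : 'M[C]_(ext_dim k n) :=
  \matrix_(a, b) if wmin f a && wmin f b then extmx k A a b else 0.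

(** Projection onto the minimal subsets; [lead] is the compression of the compound by it. *)
Let dm k f : 'M[C]_(ext_dim k n) := diag_mx (\row_a (wmin f a)%:R).

Lemma leadE k f A : lead k f A = dm k f *m extmx k A *m dm k f.
Proof.
apply/matrixP => a b; rewrite mul_mx_diag mul_diag_mx !mxE.
by case: wmin; case: wmin; rewrite ?(mulr1, mul1r, mulr0, mul0r).
Qed.

Lemma lead_tr k f A : (lead k f A)^T = lead k f A^T.
Proof.
apply/matrixP => a b; rewrite [LHS]mxE [LHS]mxE [RHS]mxE andbC extmx_tr.
by rewrite [(extmx _ _)^T _ _]mxE.
Qed.

(** The associated graded map of X, when X is filtered: [f j <= f0 i] at its nonzero entries. *)
Definition level_part f f0 X : 'M[C]_n :=
  \matrix_(i, j) if f j == f0 i then X i j else 0.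

(** At a nonzero entry (a, b) of the compound, the weight of b is at most that of a. As f and f0
    have the same minimal weight, a minimal row meets only minimal columns, and there just the
    graded part survives. *)
Lemma dm_extmx k f f0 (rho : 'I_n -> 'I_n) X : injective rho -> f =1 f0 \o rho ->
  (forall i j, X i j != 0 -> (f j <= f0 i)%N) ->
  dm k f0 *m extmx k X = extmx k (level_part f f0 X) *m dm k f.
Proof.
move=> rI fE hX; apply/matrixP => a b.
rewrite mul_mx_diag mul_diag_mx [LHS]mxE [RHS]mxE [X in X * _ = _]mxE [X in _ = _ * X]mxE.
have e1 (b' : 'I_(ext_dim k n)) : exists a' : 'I_(ext_dim k n), ext_wt f0 a' = ext_wt f b'.
  have [a' ea] := ext_wt_comp f0 b' rI; exists a'; rewrite ea.
  by apply: eq_bigr => i _; rewrite fE.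
have e2 (a' : 'I_(ext_dim k n)) : exists b' : 'I_(ext_dim k n), ext_wt f b' = ext_wt f0 a'.
  have [b' eb] := ext_wt_comp f a' (can_inj (f_invF rI)); exists b'; rewrite eb.
  by apply: eq_bigr => i _; rewrite /= fE /= f_invF.
case: (wminP f0 a) => [ma|ma]; case: (wminP f b) => [mb|mb].
- rewrite mul1r mulr1 (ext_wt_part hX) //.
  by have [a' <-] := e1 b; apply: ma.
- rewrite mul1r mulr0; apply/eqP/negPn/negP => nz; apply: mb => b'.
  have [a' <-] := e1 b'; apply: leq_trans (ma a'); exact: ext_wt_le nz.
- rewrite mul0r mulr1; apply/esym/eqP/negPn/negP => nz; apply: ma => a'.
  have [b' <-] := e2 a'; apply: leq_trans (mb b').
  have {}nz : extmx k (level_part f f0 X)^T b a != 0 by rewrite extmx_tr mxE.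
  apply: (ext_wt_le _ nz) => i j; rewrite !mxE; case: ifP => [/eqP ->//|_].
  by rewrite eqxx.
- by rewrite mul0r mulr0.
Qed.

(** On leading forms a filtered change of basis acts through its graded part: the projections move
    past the compounds of X. *)
Lemma lead_mul k f f0 (rho : 'I_n -> 'I_n) X A : injective rho -> f =1 f0 \o rho ->
  (forall i j, X i j != 0 -> (f j <= f0 i)%N) ->
  (extmx k X)^T *m lead k f0 A *m extmx k X =
  lead k f ((level_part f f0 X)^T *m A *m level_part f f0 X).
Proof.
move=> rI fE hX; rewrite !leadE !extmxM !extmx_tr !mulmxA.
have E := dm_extmx k rI fE hX.
have Et : (extmx k X)^T *m dm k f0 = dm k f *m (extmx k (level_part f f0 X))^T.
  by apply: trmx_inj; rewrite !trmx_mul !trmxK !tr_diag_mx.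
by rewrite Et -!mulmxA E !mulmxA.
Qed.

Lemma level_part_id f X : level_mx f X -> level_part f f X = X.
Proof.
move=> hX; apply/matrixP => i j; rewrite mxE; case: eqP => // ne.
by apply/esym/eqP/negPn/negP => /hX /esym.
Qed.

Lemma lead_mul_level k f X A : level_mx f X ->
  (extmx k X)^T *m lead k f A *m extmx k X = lead k f (X^T *m A *m X).
Proof.
move=> hX; rewrite (@lead_mul k f f id X A) ?level_part_id //.
by move=> i j /hX ->.
Qed.
End Lead.

(** * Supports of the normal forms *)

Section PermSupport.
Variables (C : fieldType) (n : nat).

(** The Leibniz expansion leaves only the column [s @: ext_set a], and that entry cannot vanish too
    because the compound is invertible. *)
Lemma extmx_perm_neq0 k (s : 'S_n) (a b : 'I_(ext_dim k n)) :
  (extmx k (perm_mx s : 'M[C]_n) a b != 0) = (ext_set b == s @: ext_set a).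
Proof.
have imp (a' b' : 'I_(ext_dim k n)) : extmx k (perm_mx s : 'M[C]_n) a' b' != 0 ->
    ext_set b' = s @: ext_set a'.
  rewrite mxE => /det_neq0_perm[t ht].
  apply/esym/eqP; rewrite eqEcard (card_imset _ (@perm_inj _ s)).
  rewrite !card_ext_set leqnn andbT.
  apply/fintype.subsetP => x /imsetP[y /imsetP[i _ ->] ->].
  have := ht i; rewrite !mxE; case: (eqVneq (s (ext_idx a' i)) (ext_idx b' (t i))) => [->|_].
    by rewrite imset_f.
  by rewrite eqxx.
apply/idP/eqP => [/imp //|eb].
have /row_freeP[B] : row_free (extmx k (perm_mx s : 'M[C]_n)).
  by rewrite row_free_unit extmx_unit // unitmx_perm.
move=> /matrixP/(_ a a) e1; rewrite [LHS]mxE [RHS]mxE eqxx in e1.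
apply: contraTneq (oner_neq0 C) => e0; rewrite -[1]/(true%:R) -e1 big1 ?eqxx // => b' _.
have [->|/imp e] := eqVneq (extmx k (perm_mx s : 'M[C]_n) a b') 0; first by rewrite mul0r.
have -> : b' = b by apply: ext_set_inj; rewrite e eb.
by rewrite e0 mul0r.
Qed.

Lemma ext_wt_perm k (f : 'I_n -> nat) (s : 'S_n) (a b : 'I_(ext_dim k n)) :
  (forall i, f (s i) = f i) -> ext_set b = s @: ext_set a -> ext_wt f b = ext_wt f a.
Proof.
move=> fs eb; rewrite !ext_wtE eb big_imset /=; last by move=> i j _ _; apply: perm_inj.
by apply: eq_bigr => i _.
Qed.

Lemma lead_perm_neq0 k f (s : 'S_n) (a b : 'I_(ext_dim k n)) :
  (forall i, f (s i) = f i) ->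
  (lead k f (perm_mx s : 'M[C]_n) a b != 0) = wmin f a && (ext_set b == s @: ext_set a).
Proof.
move=> fs; rewrite mxE; case: (boolP (wmin f a)) => [/wminP ma|_]; last by rewrite eqxx.
rewrite /= -extmx_perm_neq0; case: (boolP (wmin f b)) => //= nb.
rewrite eqxx; apply/esym; apply: contraNF nb; rewrite extmx_perm_neq0 => /eqP eb.
by apply/wminP => c; rewrite (ext_wt_perm fs eb).
Qed.

Lemma lead_perm_nonzero k f (s : 'S_n) : (forall i, f (s i) = f i) -> (k <= n)%N ->
  lead k f (perm_mx s : 'M[C]_n) != 0.
Proof.
move=> fs kn; have [a0 _] := ext_set_id kn; have [a ma] := wmin_exists f a0.
have [|b eb] := @ext_setP k n (s @: ext_set a).
  by rewrite (card_imset _ (@perm_inj _ s)) card_ext_set.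
apply/eqP => /matrixP/(_ a b) e0; have := @lead_perm_neq0 k f s a b fs.
by rewrite e0 mxE eqxx ma eb eqxx.
Qed.

Lemma lead_perm_tr k f (s : 'S_n) : (forall i, s (s i) = i) ->
  (lead k f (perm_mx s : 'M[C]_n))^T = lead k f (perm_mx s).
Proof.
move=> ss; rewrite lead_tr tr_perm_mx (_ : (s^-1)%g = s) //; apply/permP => r.
by apply: (@perm_inj _ s); rewrite permKV ss.
Qed.

(* One half of the uniqueness in the Bruhat decomposition; L is lower triangular for wt. *)
Lemma bruhat_support N (wt : 'I_N -> nat) (M M' Q L : 'M[C]_N) :
  M *m Q = L *m M' -> (forall b, Q b b != 0) ->
  (forall a b, L a b != 0 -> a = b \/ (wt b < wt a)%N) ->
  (forall a b b', M a b != 0 -> M a b' != 0 -> b = b') ->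
  forall a b, M a b != 0 -> exists2 a', (a' = a \/ (wt a' < wt a)%N) & M' a' b != 0.
Proof.
move=> E dQ hL row a b Mab.
have : (M *m Q) a b != 0.
  rewrite mxE (bigD1 b) //= big1 ?addr0 ?mulf_neq0 // => c cb.
  have [->|/row - /(_ _ Mab) ec] := eqVneq (M a c) 0; first by rewrite mul0r.
  by rewrite ec eqxx in cb.
rewrite E mxE => nz.
have [a' ha'] : exists a', L a a' * M' a' b != 0.
  apply: contrapT => /forallNP H; case/eqP: nz; apply: big1 => c _.
  by apply/eqP/negPn/negP/H.
move: ha'; rewrite mulf_eq0 negb_or => /andP[/hL La' M'a'].
by exists a' => //; case: La' => [->|]; [left|right].
Qed.
End PermSupport.

(** * Recovering the levels and the involution *)

Section Recover.
Variables (C : fieldType) (n : nat).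

Definition initial_levels (f : 'I_n -> nat) : Prop :=
  forall i v, (v < f i)%N -> exists j, f j = v.

(** Induction on the level: an index of level v + 1 has one of level v below it, which f' must place
    strictly lower. Used in both directions, this shows that the preorder determines the
    function. *)
Lemma initial_levels_le (f f' : 'I_n -> nat) : initial_levels f ->
  (forall i j, (f i <= f j)%N = (f' i <= f' j)%N) -> forall i, (f i <= f' i)%N.
Proof.
move=> fI ff i; have [m] := ubnP (f i); elim: m i => // m IH i; rewrite ltnS => fim.
case E: (f i) => [|v] //; have [|j fj] := fI i v; first by rewrite E.
have ij : (f' j < f' i)%N by rewrite ltnNge -ff E fj ltnn.
by apply: leq_trans ij; rewrite ltnS -fj; apply: IH; rewrite fj -E.
Qed.

(** The test sets [S g i] consist of i and all indices of strictly lower level. They are minimal, so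
    the exchange property yields the preorder, hence f; their images under s then reveal s i. *)
Lemma wmin_recover (f f' : 'I_n -> nat) (s s' : 'S_n) :
  initial_levels f -> initial_levels f' ->
  (forall i, f (s i) = f i) -> (forall i, f' (s' i) = f' i) ->
  (forall k, (0 < k < n)%N -> forall a b : 'I_(ext_dim k n),
     wmin f a && (ext_set b == s @: ext_set a)
   = wmin f' a && (ext_set b == s' @: ext_set a)) ->
  f =1 f' /\ s = s'.
Proof.
move=> fI fI' fs fs' H.
have img k (t : 'S_n) (a : 'I_(ext_dim k n)) :
    exists b : 'I_(ext_dim k n), ext_set b == t @: ext_set a.
  have [|b eb] := @ext_setP k n (t @: ext_set a); last by exists b; rewrite eb.
  by rewrite (card_imset _ (@perm_inj _ t)) card_ext_set.
have mE k (a : 'I_(ext_dim k n)) : (0 < k < n)%N -> wmin f a = wmin f' a.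
  move=> kn; apply/idP/idP => ma.
    by have [b sb] := img k s a; have := H k kn a b; rewrite ma sb => /esym/andP[].
  by have [b sb] := img k s' a; have := H k kn a b; rewrite ma sb => /andP[].
pose S (g : 'I_n -> nat) i := i |: [set l | (g l < g i)%N].
have Smin k (g : 'I_n -> nat) i (a : 'I_(ext_dim k n)) : ext_set a = S g i -> wmin g a.
  move=> ea; apply: (@exchange_wmin _ _ _ _ (g i)) => j; rewrite ea !inE.
    by case/orP => [/eqP->//|/ltnW].
  by rewrite negb_or -leqNgt => /andP[].
(* The hypothesis says nothing for k = n; an index j outside [S g i] keeps the size in range. *)
have Scard (g : 'I_n -> nat) i j : i != j -> (g i <= g j)%N -> (0 < #|S g i| < n)%N.
  move=> ij gij; apply/andP; split; first by apply/card_gt0P; exists i; rewrite !inE eqxx.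
  rewrite -[X in (_ < X)%N]card_ord -cardsT; apply: proper_card; apply/properP.
  split; first by apply/fintype.subsetP => x; rewrite inE.
  by exists j; rewrite !inE // negb_or eq_sym ij -leqNgt.
have ord_le (g g' : 'I_n -> nat) : (forall k (a : 'I_(ext_dim k n)), (0 < k < n)%N ->
    wmin g a = wmin g' a) -> forall i j, (g i <= g j)%N -> (g' i <= g' j)%N.
  move=> E i j gij; have [->//|ij] := eqVneq i j.
  have kn := Scard g i j ij gij; have [a ea] := ext_setP (erefl #|S g i|).
  have := Smin _ g i a ea; rewrite E // => ma.
  apply: (wmin_exchange ma); rewrite ea !inE ?eqxx // negb_or eq_sym ij.
  by rewrite -leqNgt.
have ff i j : (f i <= f j)%N = (f' i <= f' j)%N.
  by apply/idP/idP; apply: ord_le => k a kn; rewrite mE.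
have eff : f =1 f'.
  move=> i; apply/eqP; rewrite eqn_leq !initial_levels_le //.
split => //; apply/permP => i.
have fixF (g : 'I_n -> nat) (t : 'S_n) : (forall i, g (t i) = g i) ->
    t @: S g i = t i |: [set l | (g l < g i)%N].
  move=> gt; rewrite /S imsetU1; congr (_ |: _); apply/eqP.
  rewrite eqEcard (card_imset _ (@perm_inj _ t)) leqnn andbT.
  by apply/fintype.subsetP => x /imsetP[y]; rewrite !inE => yi ->; rewrite gt.
have fs2 i' : f (s' i') = f i' by rewrite !eff fs'.
have : s @: S f i = s' @: S f i.
  have [kn|] := boolP (0 < #|S f i| < n)%N.
    have [a ea] := ext_setP (erefl #|S f i|); have [b sb] := img _ s a.
    have := H _ kn a b; rewrite (Smin _ _ _ _ ea) sb => /esym/andP[_ sb'].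
    by move: sb sb'; rewrite ea => /eqP <- /eqP.
  (* If [S f i] is everything, no factor sees it, but every permutation preserves it. *)
  have S0 : (0 < #|S f i|)%N by apply/card_gt0P; exists i; rewrite !inE eqxx.
  rewrite S0 -leqNgt => nS.
  have -> : S f i = [set: 'I_n].
    by apply/eqP; rewrite eqEcard cardsT card_ord nS andbT; apply/fintype.subsetP => x; rewrite inE.
  have full (t : 'S_n) : t @: [set: 'I_n] = [set: 'I_n].
    apply/eqP; rewrite eqEcard (card_imset _ (@perm_inj _ t)) leqnn andbT.
    by apply/fintype.subsetP => x; rewrite inE.
  by rewrite !full.
rewrite !fixF // => /setP/(_ (s i)); rewrite !inE eqxx fs ltnn orbF => /esym.
by rewrite orbF => /eqP.
Qed.

(** [bruhat_support] for h leads from row a to some a1, and for the inverse of h from a1 to some a2,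
    with sums never increasing. Rows a and a2 meet one support in the same column b, so a2 = a, the
    sums agree and a1 = a. *)
Lemma lead_perm_support (f f' : 'I_n -> nat) (s s' : 'S_n) k (h : 'M[C]_n) c :
  (forall i, f (s i) = f i) -> (forall i, f' (s' i) = f' i) ->
  upper_mx h -> h \in unitmx -> c != 0 ->
  lead k f' (perm_mx s' : 'M[C]_n) =
    c *: ((extmx k h)^T *m lead k f (perm_mx s : 'M[C]_n) *m extmx k h) ->
  forall a b : 'I_(ext_dim k n), wmin f a && (ext_set b == s @: ext_set a)
   = wmin f' a && (ext_set b == s' @: ext_set a).
Proof.
move=> fs fs' uh Uh c0 E a b; rewrite -!(@lead_perm_neq0 C) //.
have lrow (g : 'I_n -> nat) (t : 'S_n) a1 b1 b2 : (forall i, g (t i) = g i) ->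
    lead k g (perm_mx t : 'M[C]_n) a1 b1 != 0 ->
    lead k g (perm_mx t : 'M[C]_n) a1 b2 != 0 -> b1 = b2.
  move=> gt; rewrite !lead_perm_neq0 // => /andP[_ /eqP e1] /andP[_ /eqP e2].
  by apply: ext_set_inj; rewrite e1 e2.
have lcol (g : 'I_n -> nat) (t : 'S_n) a1 a2 b1 : (forall i, g (t i) = g i) ->
    lead k g (perm_mx t : 'M[C]_n) a1 b1 != 0 ->
    lead k g (perm_mx t : 'M[C]_n) a2 b1 != 0 -> a1 = a2.
  move=> gt; rewrite !lead_perm_neq0 // => /andP[_ /eqP e1] /andP[_ /eqP e2].
  by apply: ext_set_inj; apply: (imset_inj (@perm_inj _ t)); rewrite -e1 -e2.
have half (g g' : 'I_n -> nat) (t t' : 'S_n) (b0 : 'M[C]_n) e a0 c0' :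
    (forall i, g (t i) = g i) -> upper_mx b0 -> b0 \in unitmx -> e != 0 ->
    lead k g' (perm_mx t' : 'M[C]_n) =
      e *: ((extmx k b0)^T *m lead k g (perm_mx t : 'M[C]_n) *m extmx k b0) ->
    lead k g (perm_mx t : 'M[C]_n) a0 c0' != 0 ->
    exists2 a', a' = a0 \/ (ext_wt val a' < ext_wt val a0)%N
      & lead k g' (perm_mx t' : 'M[C]_n) a' c0' != 0.
  move=> gt ub Ub e0 Eg.
  apply: (@bruhat_support C _ (ext_wt val) _ _ (extmx k b0)
     (e^-1 *: (extmx k (invmx b0))^T)).
  - rewrite Eg -scalemxAl -scalemxAr scalerA mulVf // scale1r !mulmxA.
    by rewrite -trmx_mul -extmxM mulmxV // extmx1 trmx1 mul1mx.
  - move=> b1; rewrite extmx_upper_diag //; apply/prodf_neq0 => i _.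
    by move/(upper_unitP ub): Ub; apply.
  - move=> a1 b1; rewrite !mxE mulf_eq0 negb_or => /andP[_ nz].
    have /(extmx_upper_neq0 (upper_inv Ub ub)) : extmx k (invmx b0) b1 a1 != 0 by rewrite mxE.
    by case=> [->|]; [left|right].
  - by move=> a1 b1 b2; apply: lrow.
have E' : lead k f (perm_mx s : 'M[C]_n) =
    c^-1 *: ((extmx k (invmx h))^T *m lead k f' (perm_mx s' : 'M[C]_n) *m extmx k (invmx h)).
  rewrite E -scalemxAr -scalemxAl scalerA mulVf // scale1r !mulmxA -trmx_mul -extmxM.
  rewrite mulmxV // extmx1 trmx1 mul1mx -mulmxA -extmxM mulmxV //.
  by rewrite extmx1 mulmx1.
have uh' := upper_inv Uh uh; have Uh' : invmx h \in unitmx by rewrite unitmx_inv.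
have c0' : c^-1 != 0 by rewrite invr_eq0.
apply/idP/idP => nz.
  have [a1 l1 n1] := half _ _ _ _ _ _ _ _ fs uh Uh c0 E nz.
  have [a2 l2 n2] := half _ _ _ _ _ _ _ _ fs' uh' Uh' c0' E' n1.
  have e2 : a2 = a by apply: lcol n2 nz.
  case: l1 => [<-//|l1]; rewrite e2 in l2; case: l2 => [->//|l2].
  by have := ltn_trans l1 l2; rewrite ltnn.
have [a1 l1 n1] := half _ _ _ _ _ _ _ _ fs' uh' Uh' c0' E' nz.
have [a2 l2 n2] := half _ _ _ _ _ _ _ _ fs uh Uh c0 E n1.
have e2 : a2 = a by apply: lcol n2 nz.
case: l1 => [<-//|l1]; rewrite e2 in l2; case: l2 => [->//|l2].
by have := ltn_trans l1 l2; rewrite ltnn.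
Qed.
End Recover.

(** * Points and orbits *)

Lemma trmx_scale (C : pzRingType) m p (c : C) (A : 'M[C]_(m, p)) : (c *: A)^T = c *: A^T.
Proof. by apply/matrixP => i j; rewrite !mxE. Qed.

Section Lines.
Variables (C : fieldType) (N : nat).

Lemma line_eqP (v w : 'M[C]_N) : v != 0 -> <[v]>%VS = <[w]>%VS ->
  exists2 c, c != 0 & v = c *: w.
Proof.
move=> v0 e; have /vlineP[c vc] : v \in <[w]>%VS by rewrite -e memv_line.
by exists c => //; apply: contraNneq v0 => c0; rewrite vc c0 scale0r.
Qed.

Lemma line_scale (w : 'M[C]_N) c : c != 0 -> <[c *: w]>%VS = <[w]>%VS.
Proof.
move=> c0; apply/eqP; rewrite eqEsubv -!memvE; apply/andP; split.
  by rewrite memvZ ?memv_line.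
by rewrite -[X in X \in _](scalerK c0) memvZ ?memv_line.
Qed.
End Lines.

Section Points.
Variables (C : fieldType) (n : nat).

Lemma proj_sym_line N (U : proj_sym C N) :
  exists v : 'M[C]_N, [/\ v != 0, v^T = v & sval U = <[v]>%VS].
Proof.
case: U => U /= /andP[/eqP dU sU]; exists (vpick U).
have U0 : vpick U != 0.
  by rewrite vpick0; apply: contraTneq isT => U0; move: dU; rewrite U0 dimv0.
split => //; first by apply/symvP/(subvP sU)/memv_pick.
by apply/esym/eqP; rewrite eqEdim dU dim_vline U0 -memvE memv_pick.
Qed.

Lemma represents_exists (x : ambient C n) : exists v, represents v x.
Proof.
have ex i : exists v, sval (x i) = <[v]>%VS.
  by have [v []] := proj_sym_line (x i); exists v.
by exists (fun i => projT1 (cid (ex i))) => i; case: cid.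
Qed.

Lemma represents_neq0 (x : ambient C n) v i : represents v x -> v i != 0.
Proof.
move=> /(_ i) xv; apply: contraTneq isT => v0; have := valP (x i).
by rewrite [val _]xv v0 dim_vline eqxx.
Qed.

Lemma point_exists (v : forall i : 'I_n.-1, 'M[C]_(ext_dim i.+1 n)) :
  (forall i, (v i)^T = v i) -> (forall i, v i != 0) ->
  exists x : ambient C n, represents v x.
Proof.
move=> vs v0.
have H i : (\dim <[v i]> == 1)%N && (<[v i]> <= symv C (ext_dim i.+1 n))%VS.
  by rewrite dim_vline v0 -memvE; apply/symvP.
by exists (fun i => exist _ <[v i]>%VS (H i)) => i.
Qed.

Lemma ambient_eq (x y : ambient C n) v : represents v x -> represents v y -> x = y.
Proof.
move=> xv yv; apply: functional_extensionality_dep => i; apply: val_inj.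
by rewrite [val _]xv [RHS]yv.
Qed.

Lemma ext_act_line k (g : 'M[C]_n) v :
  (ext_act k g @: <[v]>)%VS =
  <[(extmx k (invmx g))^T *m v *m extmx k (invmx g)]>%VS.
Proof. by rewrite limg_line comp_lfunE !lfunE /= -trmx_inv extmx_tr. Qed.
End Points.

Section Orbits.
Variables (C : numClosedFieldType) (n : nat) (n0 : (0 < n)%N).
Implicit Types (x y z : ambient C n).

(** The condition det = 1 disappears: dividing h by an n-th root of its determinant only scales each
    compound, which does not move a line. *)
Lemma borel_orbitP x y v w : represents v x -> represents w y ->
  borel_orbit x y <-> exists h : 'M[C]_n, [/\ upper_mx h, h \in unitmx
    & forall i, <[w i]>%VS = <[(extmx i.+1 h)^T *m v i *m extmx i.+1 h]>%VS].
Proof.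
move=> xv yw; split=> [[g [dg ug] gy]|[h [uh Uh hE]]].
  have Ug : g \in unitmx by rewrite unitmxE dg unitr1.
  exists (invmx g); split; [exact: upper_inv|by rewrite unitmx_inv|].
  by move=> i; rewrite -yw gy xv ext_act_line.
pose c := n.-root (\det h).
have cn : c ^+ n = \det h by rewrite rootCK.
have dh : \det h != 0 by rewrite -unitfE -unitmxE.
have c0 : c != 0 by apply: contraNneq dh => c0; rewrite -cn c0 expr0n gtn_eqF.
have Uc : c^-1 *: h \in unitmx by rewrite unitmxZ // unitfE invr_eq0.
exists (invmx (c^-1 *: h)).
  split; first by rewrite det_inv detZ exprVn cn mulVf // invr1.
  by apply: upper_inv => // i j ij; rewrite mxE uh ?mulr0.
move=> i; rewrite yw xv ext_act_line invmxK hE extmxZ.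
rewrite trmx_scale -!scalemxAl -scalemxAr scalerA.
by rewrite line_scale // mulf_neq0 // expf_neq0 // invr_eq0.
Qed.

Lemma borel_orbit_refl x : borel_orbit x x.
Proof.
have [v xv] := represents_exists x; apply/(borel_orbitP xv xv).
exists 1%:M; split; [exact: upper_mx1|exact: unitmx1|].
by move=> i; rewrite extmx1 trmx1 mul1mx mulmx1.
Qed.

Lemma borel_orbit_sym x y : borel_orbit x y -> borel_orbit y x.
Proof.
have [v xv] := represents_exists x; have [w yw] := represents_exists y.
move=> /(borel_orbitP xv yw)[h [uh Uh hE]]; apply/(borel_orbitP yw xv).
exists (invmx h); split; [exact: upper_inv|by rewrite unitmx_inv|] => i.
have [c c0 ->] := line_eqP (represents_neq0 i yw) (hE i).
rewrite -scalemxAr -scalemxAl line_scale // !mulmxA -trmx_mul -extmxM mulmxV //.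
by rewrite extmx1 trmx1 mul1mx -mulmxA -extmxM mulmxV // extmx1 mulmx1.
Qed.

Lemma borel_orbit_trans x y z : borel_orbit x y -> borel_orbit y z -> borel_orbit x z.
Proof.
have [u xu] := represents_exists x; have [v yv] := represents_exists y.
have [w zw] := represents_exists z.
move=> /(borel_orbitP xu yv)[h [uh Uh hE]] /(borel_orbitP yv zw)[g [ug Ug gE]].
apply/(borel_orbitP xu zw); exists (h *m g); split.
- exact: upper_mxM.
- by rewrite unitmx_mul Uh.
move=> i; rewrite gE; have [c c0 ->] := line_eqP (represents_neq0 i yv) (hE i).
by rewrite -scalemxAr -scalemxAl line_scale // extmxM trmx_mul !mulmxA.
Qed.

Lemma borel_orbit_eq x y : borel_orbit x y -> borel_orbit x = borel_orbit y.
Proof.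
move=> xy; apply/seteqP; split => z.
  exact: borel_orbit_trans (borel_orbit_sym xy).
exact: borel_orbit_trans.
Qed.
End Orbits.

Lemma horner_mmap (C : fieldType) m (p : {mpoly C[m]}) (g : 'I_m -> {poly C}) t :
  (mmap polyC g p).[t] = p.@[fun i => (g i).[t]].
Proof.
rewrite mevalE /mmap horner_sum; apply: eq_bigr => e _.
rewrite hornerM hornerC /mmap1 horner_prod; congr (_ * _).
by apply: eq_bigr => i _; rewrite horner_exp.
Qed.

(** The product q s vanishes at the integers 0, 1, 2, ..., more of them than a nonzero polynomial of
    its degree allows. *)
Lemma poly_vanish (C : numFieldType) (q s : {poly C}) :
  s != 0 -> (forall t, s.[t] != 0 -> q.[t] = 0) -> q = 0.
Proof.
move=> s0 H; apply/eqP/negPn/negP => q0.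
have qs0 : q * s != 0 by rewrite mulf_neq0.
pose r : seq C := map (fun i => i%:R) (iota 0 (size (q * s))).
have := max_poly_roots qs0 (rs := r); rewrite size_map size_iota ltnn => F.
suff : false by []; apply: F.
  apply/allP => _ /mapP[i _ ->]; rewrite rootE hornerM.
  by have [->|/H ->] := eqVneq s.[i%:R] 0; rewrite ?mulr0 ?mul0r.
rewrite map_inj_uniq ?iota_uniq // => i j /eqP.
by rewrite eqr_nat => /eqP.
Qed.

(** * Limits of polynomial curves lie in the closure *)

Section Curve.
Variables (C : numFieldType) (n : nat).

(** Along the curve p becomes a polynomial in t that vanishes for t != 0, hence also at 0. The
    scalars c may depend on t in any way, since vanishing at a point concerns all its
    representatives. *)
Lemma closure_curve (x : ambient C n)
    (vp : forall i : 'I_n.-1, 'M[{poly C}]_(ext_dim i.+1 n)) :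
  represents (fun i => map_mx (horner_eval 0) (vp i)) x ->
  (forall t : C, t != 0 -> exists A : 'M[C]_n, [/\ A^T = A, A \in unitmx &
     forall i, exists2 c : C, c != 0 & map_mx (horner_eval t) (vp i) = c *: extmx i.+1 A]) ->
  complete_quadrics C n x.
Proof.
move=> xv curve p pm pS w xw.
have ex i : exists e : C, e != 0 /\ w i = e *: map_mx (horner_eval 0) (vp i).
  have := xv i; rewrite xw => /(line_eqP (represents_neq0 i xw))[c c0 ->].
  by exists c.
have [e eE] := choice ex.
(* The factors [e] make the curve pass through the given representative w at t = 0. *)
pose g (c : 'I_#|{: coord_idx n}|) : {poly C} :=
  let u := enum_val c in (e (tag u))%:P * vp (tag u) (tagged u).1 (tagged u).2.
have gE t : (mmap polyC g p).[t] =
    p.@[coord_val (fun i => e i *: map_mx (horner_eval t) (vp i))].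
  rewrite horner_mmap; apply: meval_eq => c.
  by rewrite /g /coord_val hornerM hornerC !mxE.
suff q0 : mmap polyC g p = 0.
  have := gE 0; rewrite q0 horner0 => /esym <-; apply: meval_eq => c.
  by rewrite /coord_val (eE _).2.
apply: (@poly_vanish C _ 'X); first by rewrite polyX_eq0.
move=> t; rewrite hornerX => t0; have [A [As AU AE]] := curve t t0.
have eA0 (i : 'I_n.-1) : extmx i.+1 A != 0.
  apply/eqP => A0; move/eqP: (represents_neq0 i xw); apply.
  have := extmx_unit i.+1 AU; rewrite A0 => U0.
  have -> : w i = w i *m 0 *m invmx 0 by rewrite mulmxK.
  by rewrite mulmx0 mul0mx.
have [|y yA] := @point_exists C n (fun i => extmx i.+1 A) _ eA0.
  by move=> i; rewrite -extmx_tr As.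
rewrite gE; apply: (pS y); first by exists A.
move=> i; rewrite yA; have [c c0 ->] := AE i.
by rewrite scalerA line_scale // mulf_neq0 // (eE i).1.
Qed.

(** Row a of the compound of diag(t^f) P_s carries t to the weight of a. Dividing by the lowest
    power t^(m i) gives a polynomial curve, of which only the minimal rows remain at t = 0; their
    columns are minimal because s preserves levels. *)
Lemma lead_point_closure (f : 'I_n -> nat) (s : 'S_n) x :
  (forall i, s (s i) = i) -> (forall i, f (s i) = f i) ->
  represents (fun i => lead i.+1 f (perm_mx s : 'M[C]_n)) x ->
  complete_quadrics C n x.
Proof.
move=> ss fs xv.
have [ext0|ext0] := boolP [forall i : 'I_n.-1, (0 < ext_dim i.+1 n)%N]; last first.
  move: ext0; rewrite negb_forall => /existsP[i e0]; move: e0; rewrite -eqn0Ngt => /eqP e0.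
  have := represents_neq0 i xv; case/eqP; apply/matrixP => a.
  by exfalso; move: a; rewrite e0 => -[].
have mw (i : 'I_n.-1) : exists m, exists2 a : 'I_(ext_dim i.+1 n), wmin f a & m = ext_wt f a.
  have [a ma] := wmin_exists f (Ordinal (forallP ext0 i)).
  by exists (ext_wt f a); exists a.
have [m mE] := choice mw.
pose vp (i : 'I_n.-1) : 'M[{poly C}]_(ext_dim i.+1 n) :=
  \matrix_(a, b) ((extmx i.+1 (perm_mx s : 'M[C]_n) a b)%:P * 'X^(ext_wt f a - m i)).
apply: (@closure_curve _ vp).
  suff -> : (fun i => map_mx (horner_eval 0) (vp i)) =
      (fun i => lead i.+1 f (perm_mx s : 'M[C]_n)) by [].
  apply: functional_extensionality_dep => i; apply/matrixP => a b.
  rewrite [RHS]mxE [LHS]mxE [vp i a b]mxE /horner_eval hornerM hornerC hornerXn.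
  have [a0 /wminP ma0 e0] := mE i.
  case: (wminP f a) => [ma|na] /=.
    have -> : ext_wt f a = m i by apply/eqP; rewrite eqn_leq e0 ma ma0.
    rewrite subnn expr0 mulr1; case: (boolP (wmin f b)) => // nb.
    apply/eqP; apply: contraNT nb; rewrite extmx_perm_neq0 => /eqP eb.
    by apply/wminP => c; rewrite (ext_wt_perm fs eb).
  suff mlt : (m i < ext_wt f a)%N by rewrite expr0n subn_eq0 leqNgt mlt mulr0.
  by rewrite ltnNge; apply/negP => le; apply: na => b'; rewrite (leq_trans le) // e0.
move=> t t0; pose D : 'M[C]_n := diag_mx (\row_i t ^+ f i).
exists (D *m perm_mx s); split.
- apply/matrixP => i j; rewrite mxE !mul_diag_mx !mxE.
  have -> : (s i == j) = (s j == i) by apply/eqP/eqP => <-; rewrite ss.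
  by case: (eqVneq (s j) i) => [<-|_]; rewrite ?mulr0 // fs.
- rewrite unitmx_mul unitmx_perm andbT; apply/upper_unitP.
    by move=> i j ij; rewrite !mxE -val_eqE gtn_eqF.
  by move=> i; rewrite !mxE eqxx expf_neq0.
move=> i; exists (t ^+ m i)^-1; first by rewrite invr_eq0 expf_neq0.
apply/matrixP => a b; rewrite [LHS]mxE [vp i a b]mxE /horner_eval hornerM hornerC hornerXn.
rewrite [RHS]mxE extmxM extmx_diag mul_diag_mx [in RHS]mxE [X in _ * (X * _)]mxE mulrC mulrA.
congr (_ * _); under eq_bigr => l _ do rewrite mxE.
rewrite -expr_sum; have [a0 /wminP ma0 e0] := mE i.
have le : (m i <= ext_wt f a)%N by rewrite e0.
by rewrite -/(ext_wt f a) -[in RHS](subnK le) exprD mulrC mulfK ?expf_neq0.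
Qed.
End Curve.

(** * Multihomogeneous functions *)

Section Multihomogeneous.
Variables (C : numFieldType) (n : nat).
Local Notation tuples := (forall i : 'I_n.-1, 'M[C]_(ext_dim i.+1 n)).
Implicit Types (F G : tuples -> C) (d : 'I_n.-1 -> nat).

Definition mhom d F := exists p : {mpoly C[#|{: coord_idx n}|]},
  (forall i, p \is ishomog1 (d i) (factor_deg i)) /\
  forall v, F v = p.@[coord_val v].

Lemma eq_mhom d d' F G : d =1 d' -> F =1 G -> mhom d F -> mhom d' G.
Proof.
move=> dd FG [p [ph pF]]; exists p; split; first by move=> i; rewrite -dd.
by move=> v; rewrite -FG.
Qed.

Lemma mhom0 d : mhom d (fun=> 0).
Proof. by exists 0; split => [i|v]; rewrite ?dhomog0 ?meval0. Qed.

Lemma mhom1 : mhom (fun=> 0%N) (fun=> 1).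
Proof. by exists 1; split => [i|v]; rewrite ?dhomog1 ?meval1. Qed.

Lemma mhomD d F G : mhom d F -> mhom d G -> mhom d (fun v => F v + G v).
Proof.
move=> [p [hp pF]] [q [hq qG]]; exists (p + q); split=> [i|v].
  by apply: dhomogD.
by rewrite mevalD pF qG.
Qed.

Lemma mhomZ d c F : mhom d F -> mhom d (fun v => c * F v).
Proof.
move=> [p [hp pF]]; exists (c *: p); split=> [i|v]; last by rewrite mevalZ pF.
exact: dhomogZ.
Qed.

Lemma mhomM d e F G : mhom d F -> mhom e G ->
  mhom (fun i => d i + e i)%N (fun v => F v * G v).
Proof.
move=> [p [hp pF]] [q [hq qG]]; exists (p * q); split=> [i|v].
  exact: dhomogM.
by rewrite mevalM pF qG.
Qed.

Lemma mhom_sum d (I : finType) (P : pred I) (F : I -> tuples -> C) :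
  (forall i, P i -> mhom d (F i)) -> mhom d (fun v => \sum_(i | P i) F i v).
Proof.
move=> H; suff: forall s : seq I, mhom d (fun v => \sum_(i <- s | P i) F i v) by [].
elim=> [|i s IH]; first by apply: eq_mhom (mhom0 d) => // v; rewrite big_nil.
have [Pi|nPi] := boolP (P i).
  by apply: eq_mhom (mhomD (H i Pi) IH) => // v; rewrite big_cons Pi.
by apply: eq_mhom IH => // v; rewrite big_cons (negPf nPi).
Qed.

Lemma mhom_prod (I : finType) (d : I -> 'I_n.-1 -> nat) (F : I -> tuples -> C) :
  (forall i, mhom (d i) (F i)) ->
  mhom (fun j => \sum_i d i j)%N (fun v => \prod_i F i v).
Proof.
move=> H; suff: forall s : seq I,
  mhom (fun j => \sum_(i <- s) d i j)%N (fun v => \prod_(i <- s) F i v) by [].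
elim=> [|i s IH].
  by apply: eq_mhom mhom1 => [j|v]; rewrite big_nil.
by apply: eq_mhom (mhomM (H i) IH) => [j|v]; rewrite big_cons.
Qed.

Lemma mhomX d F m : mhom d F -> mhom (fun i => m * d i)%N (fun v => F v ^+ m).
Proof.
move=> hF; elim: m => [|m IH].
  by apply: eq_mhom mhom1 => [j|v]; rewrite ?mul0n ?expr0.
by apply: eq_mhom (mhomM hF IH) => [j|v]; rewrite ?mulSn ?exprS.
Qed.

Lemma mhom_coord i S T : mhom (fun j => (i == j) : nat) (fun v => v i S T).
Proof.
pose c := enum_rank (Tagged (fun i : 'I_n.-1 =>
   ('I_(ext_dim i.+1 n) * 'I_(ext_dim i.+1 n))%type) (S, T)).
exists 'X_c; split=> [j|v]; last first.
  by rewrite mevalXU /coord_val enum_rankK.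
rewrite dhomogX /= /factor_deg; apply/eqP.
transitivity (\sum_(c' < #|{: coord_idx n}| | tag (enum_val c') == j) (c == c'))%N.
  by apply: eq_bigr => c' _; rewrite mnm1E.
have [ij|nij] := eqVneq i j.
  rewrite (bigD1 c) /=; last by rewrite enum_rankK /= ij.
  by rewrite eqxx big1 // => c' /andP[_ /negPf]; rewrite eq_sym => ->.
rewrite big1 // => c' c'j; case: (eqVneq c c') => // cc; move: c'j.
by rewrite -cc enum_rankK /= (negPf nij).
Qed.

(** Every representative of a nondegenerate point is a tuple of scaled compounds, so testing F there
    is enough. *)
Lemma closure_vanish d F (x : ambient C n) v : mhom d F ->
  (forall (A : 'M[C]_n) (c : 'I_n.-1 -> C), A^T = A -> A \in unitmx ->
     (forall i, c i != 0) -> F (fun i => c i *: extmx i.+1 A) = 0) ->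
  complete_quadrics C n x -> represents v x -> F v = 0.
Proof.
move=> [p [hp pF]] H clx xv; rewrite pF; apply: clx => //; first by exists d.
move=> y [A [As AU yA]] w yw; rewrite -pF.
have ex i : exists c : C, c != 0 /\ w i = c *: extmx i.+1 A.
  by have := yA i; rewrite yw => /(line_eqP (represents_neq0 i yw))[c c0 ->]; exists c.
have [c cE] := choice ex.
have -> : w = (fun i => c i *: extmx i.+1 A).
  by apply: functional_extensionality_dep => i; rewrite (cE i).2.
by apply: H => // i; rewrite (cE i).1.
Qed.
End Multihomogeneous.

(** * Genericity by restriction to lines *)

Section LinePolynomial.
Variables (C : numFieldType) (n : nat).
Implicit Types (phi : 'M[C]_n -> C).

Definition line_poly phi := forall X Y, exists p : {poly C},
  forall t, phi (X + t *: Y) = p.[t].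

(** Induction: on the line joining a good point of the product to a good point of the next factor,
    both restrict to nonzero polynomials in t, and so does their product. *)
Lemma line_poly_common (I : Type) (phi : I -> 'M[C]_n -> C) (s : seq I) :
  (forall i, line_poly (phi i)) -> (forall i, exists X, phi i X != 0) ->
  exists X, \prod_(i <- s) phi i X != 0.
Proof.
move=> hp hn.
have hprod s' : line_poly (fun X => \prod_(i <- s') phi i X).
  elim: s' => [|i s' IH] X Y; first by exists 1 => t; rewrite big_nil hornerC.
  have [p pE] := hp i X Y; have [q qE] := IH X Y.
  by exists (p * q) => t; rewrite big_cons hornerM pE qE.
elim: s => [|i s [X hX]]; first by exists 0; rewrite big_nil oner_neq0.
have [Y hY] := hn i.
have [p pE] := hp i X (Y - X); have [q qE] := hprod s X (Y - X).
have p0 : p != 0.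
  apply: contraNneq hY => p0; have := pE 1; rewrite p0 horner0 scale1r.
  by rewrite addrC subrK => ->.
have q0 : q != 0.
  apply: contraNneq hX => q0; have := qE 0.
  by rewrite q0 horner0 scale0r addr0 => ->.
have [t ht] : exists t, (p * q).[t] != 0.
  apply: contrapT => /forallNP H.
  have pq0 : p * q = 0.
    apply: (@poly_vanish C _ 1); first exact: oner_neq0.
    by move=> t _; apply/eqP/negPn/negP/H.
  by move/eqP: pq0; rewrite mulf_eq0 (negPf p0) (negPf q0).
by exists (X + t *: (Y - X)); rewrite big_cons pE qE -hornerM.
Qed.

Lemma map_line (X Y : 'M[C]_n) t :
  map_mx (horner_eval t) (map_mx polyC X + 'X *: map_mx polyC Y) = X + t *: Y.
Proof. by apply/matrixP => i j; rewrite !mxE /horner_eval !hornerE. Qed.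

Lemma line_poly_det : line_poly (fun X => \det X).
Proof.
move=> X Y; exists (\det (map_mx polyC X + 'X *: map_mx polyC Y)) => t.
by rewrite -map_line det_map_mx.
Qed.

Lemma line_poly_compound k (v : 'M[C]_(ext_dim k n)) a :
  line_poly (fun X => ((extmx k X)^T *m v *m extmx k X) a a).
Proof.
move=> X Y; set M := (map_mx polyC X + 'X *: map_mx polyC Y).
exists (((extmx k M)^T *m map_mx polyC v *m extmx k M) a a) => t.
rewrite -map_line extmx_map map_trmx.
have vE : v = map_mx (horner_eval t) (map_mx polyC v).
  by apply/matrixP => i j; rewrite !mxE /horner_eval hornerC.
by rewrite {1}vE -!map_mxM mxE.
Qed.
End LinePolynomial.

(** * Nonvanishing of the leading entries *)

Section Generic.
Variables (C : numClosedFieldType) (n : nat).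

(** With a single level the Borel normal form leaves a symmetric permutation matrix, which has a
    symmetric square root. The factorisation turns a trace against the compound of A into a sum of
    values on decomposable vectors. *)
Lemma sym_gram (A : 'M[C]_n) : A^T = A -> A \in unitmx ->
  exists Y : 'M[C]_n, A = Y *m Y^T.
Proof.
move=> As AU.
have [|s [ss _ [b [_ Ub _ E]]]] := @sym_borel_normal C n (fun=> 0%N) A As AU.
  by [].
pose P : 'M[C]_n := perm_mx s.
have PP : P *m P = 1%:M.
  rewrite -perm_mxM (_ : (s * s)%g = 1%g) ?perm_mx1 //.
  by apply/permP => i; rewrite permM perm1 ss.
have Pt : P^T = P.
  rewrite tr_perm_mx; congr perm_mx; apply/permP => i.
  by apply: (@perm_inj _ s); rewrite permKV ss.
(* (alpha + beta P)^2 = P as alpha^2 + beta^2 = 0 and 2 alpha beta = 1 *)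
pose al : C := sqrtC (2%:R * 'i)^-1; pose be := 'i * al.
have i0 : (2%:R * 'i : C) != 0 by rewrite mulf_neq0 ?pnatr_eq0 ?neq0Ci.
have al2 : al * al = (2%:R * 'i)^-1 by rewrite -expr2 sqrtCK.
pose Z := al%:M + be *: P.
have ZZ : Z *m Z^T = P.
  have -> : Z^T = Z by rewrite /Z linearD /= tr_scalar_mx trmx_scale Pt.
  have -> : Z *m Z = (al * al + be * be)%:M + (al * be + be * al) *: P.
    rewrite /Z mulmxDl !mulmxDr !mul_scalar_mx mul_mx_scalar.
    rewrite -[(be *: P) *m _]scalemxAl -scalemxAr PP !scalerA.
    rewrite !scale_scalar_mx mulr1 raddfD scalerDl /= -!addrA; congr (_ + _).
    by rewrite addrA addrC [be * al]mulrC.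
  have -> : be * be = - (al * al).
    by rewrite /be mulrACA -expr2 sqrCi mulN1r.
  have -> : al * be + be * al = 1.
    rewrite [be * al]mulrC /be mulrCA al2.
    by rewrite -mulrDl -mulr2n -[X in X / _]mulr_natl mulfV.
  by rewrite subrr scale1r raddf0 add0r.
exists ((invmx b)^T *m Z); rewrite trmx_mul trmxK mulmxA -[_ *m Z *m Z^T]mulmxA ZZ /P E.
rewrite !mulmxA -trmx_mul mulmxV // trmx1 mul1mx -mulmxA mulmxV //.
by rewrite mulmx1.
Qed.

Lemma map_conj_unit (A : 'M[C]_n) : A \in unitmx -> map_mx Num.conj A \in unitmx.
Proof. by rewrite map_unitmx. Qed.

(** Otherwise [v i] has trace zero against the compound of every A = Y Y^T. Up to conjugation this
    says that the linear form F vanishes at all nondegenerate points, hence at v, which forces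
    [v i = 0]. *)
Lemma generic_entry (x : ambient C n) v (i : 'I_n.-1) a0 :
  complete_quadrics C n x -> represents v x ->
  exists g : 'M[C]_n, ((extmx i.+1 g)^T *m v i *m extmx i.+1 g) a0 a0 != 0.
Proof.
move=> clx xv; apply: contrapT => /forallNP H.
have {}H (g : 'M[C]_n) : ((extmx i.+1 g)^T *m v i *m extmx i.+1 g) a0 a0 = 0.
  by apply/eqP/negPn/negP/H.
(* As g need not be invertible, [colsub phi Y] may copy the columns of Y indexed by a into the
   positions of a0. *)
have Hd (Y : 'M[C]_n) a : ((extmx i.+1 Y)^T *m v i *m extmx i.+1 Y) a a = 0.
  pose phi j := if [pick l | ext_idx a0 l == j] is Some l then ext_idx a l else j.
  have phiE l : phi (ext_idx a0 l) = ext_idx a l.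
    rewrite /phi; case: pickP => [l' /eqP/ext_idx_inj ->//|/(_ l)].
    by rewrite eqxx.
  have colE S : extmx i.+1 (colsub phi Y) S a0 = extmx i.+1 Y S a.
    by rewrite !mxE; congr (\det _); apply/matrixP => l m; rewrite !mxE phiE.
  rewrite -[RHS](H (colsub phi Y)) mxE [RHS]mxE; apply: eq_bigr => T _.
  rewrite colE; congr (_ * _); rewrite mxE [RHS]mxE; apply: eq_bigr => S _.
  by rewrite mxE [in RHS]mxE colE.
have Ht (A : 'M[C]_n) : A^T = A -> A \in unitmx -> \tr (v i *m extmx i.+1 A) = 0.
  move=> As AU; have [Y ->] := sym_gram As AU.
  rewrite extmxM extmx_tr mulmxA mxtrace_mulC mulmxA /mxtrace.
  by apply: big1 => a _; apply: Hd.
pose F w : C := \sum_S \sum_T (v i S T)^* * (w : forall i : 'I_n.-1, 'M[C]_(ext_dim i.+1 n)) i S T.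
have hF : mhom (fun j => (i == j) : nat) F.
  apply: mhom_sum => S _; apply: mhom_sum => T _; apply: mhomZ.
  exact: mhom_coord.
(* F v is the squared norm of v i. *)
have F0 : F v = 0.
  apply: (closure_vanish hF _ clx xv) => A c As AU c0.
  have := Ht (map_mx Num.conj A); rewrite map_trmx As => /(_ erefl (map_conj_unit AU)).
  move=> /(congr1 Num.conj); rewrite rmorph0 => E.
  rewrite -[RHS](mulr0 (c i)) -E /mxtrace rmorph_sum mulr_sumr; apply: eq_bigr => S _.
  rewrite mxE rmorph_sum mulr_sumr; apply: eq_bigr => T _.
  rewrite rmorphM [extmx _ _ T S](_ : _ = (extmx i.+1 A S T)^*); last first.
    by rewrite -[in RHS]As extmx_tr extmx_map !mxE.
  by rewrite /= conjCK mxE mulrCA.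
have := represents_neq0 i xv => /eqP; apply; apply/matrixP => S T; rewrite mxE.
have pos S' T' : 0 <= (v i S' T')^* * v i S' T' by rewrite mulrC mul_conjC_ge0.
have := F0 => /eqP; rewrite psumr_eq0; last by move=> S' _; apply: sumr_ge0 => T' _.
move=> /allP/(_ S (mem_index_enum _)); rewrite /= psumr_eq0 //.
move=> /allP/(_ T (mem_index_enum _)); rewrite /= mulrC mul_conjC_eq0.
by move/eqP.
Qed.

Lemma generic_point (x : ambient C n) v (a0 : forall i : 'I_n.-1, 'I_(ext_dim i.+1 n)) :
  complete_quadrics C n x -> represents v x ->
  exists2 g : 'M[C]_n, g \in unitmx &
    forall i : 'I_n.-1, ((extmx i.+1 g)^T *m v i *m extmx i.+1 g) (a0 i) (a0 i) != 0.
Proof.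
move=> clx xv.
pose phi (o : option 'I_n.-1) (X : 'M[C]_n) := if o is Some i
  then ((extmx i.+1 X)^T *m v i *m extmx i.+1 X) (a0 i) (a0 i) else \det X.
have [||g] := @line_poly_common C n _ phi (None :: map Some (enum 'I_n.-1)).
- by case=> [i|]; [apply: line_poly_compound|apply: line_poly_det].
- case=> [i|]; first by have [g hg] := generic_entry (a0 i) clx xv; exists g.
  by exists 1%:M; rewrite /= det1 oner_neq0.
rewrite big_cons mulf_eq0 negb_or => /andP[dg].
rewrite big_map => pg; exists g; first by rewrite unitmxE unitfE.
move=> i; apply: contraNneq pg => e0.
by rewrite (bigD1_seq i) ?mem_enum ?enum_uniq //= e0 mul0r.
Qed.
End Generic.

(** * The chart *)

Section Initial.
Variable n : nat.

Lemma ext_lt (i : 'I_n.-1) : (i.+1 <= n)%N.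
Proof. by case: i => i; case: n => //= m im; apply: leqW. Qed.

Definition ext_ini (i : 'I_n.-1) : 'I_(ext_dim i.+1 n) :=
  projT1 (cid (ext_set_id (ext_lt i))).

Lemma ext_iniE i l : ext_idx (ext_ini i) l = l :> nat.
Proof. exact: (projT2 (cid (ext_set_id (ext_lt i))) l). Qed.

(* The subset {0, .., i - 1, j}; a junk value when j < i. *)
Definition ext_last (i : 'I_n.-1) (j : 'I_n) : 'I_(ext_dim i.+1 n) :=
  odflt (ext_ini i) [pick b : 'I_(ext_dim i.+1 n) |
    [forall l, ext_idx b l == (if (l < i)%N then l : nat else j) :> nat]].

Lemma ext_lastE (i : 'I_n.-1) (j : 'I_n) l : (i <= j)%N ->
  ext_idx (ext_last i j) l = (if (l < i)%N then l : nat else j) :> nat.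
Proof.
move=> ij; rewrite /ext_last; case: pickP => [b /forallP/(_ l)/eqP //|H].
pose F (l : 'I_i.+1) : 'I_n := if (l < i)%N then widen_ord (ext_lt i) l else j.
have [|b bE] := @ext_idxP i.+1 n F.
  move=> l1 l2 l12; rewrite /F; have := ltn_ord l2; rewrite ltnS => l2i.
  rewrite (leq_trans l12) //; case: ifP => [//|_] /=.
  exact: leq_trans l12 (leq_trans l2i ij).
have /negP[] := negbT (H b); apply/forallP => m; rewrite bE /F.
by case: ifP.
Qed.

Lemma ext_ini_min (i : 'I_n.-1) (b : 'I_(ext_dim i.+1 n)) : ~ (ext_wt val b < ext_wt val (ext_ini i))%N.
Proof.
apply/negP; rewrite -leqNgt; apply: leq_sum => l _.
by rewrite [val _]ext_iniE; apply: ext_idx_ge.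
Qed.
End Initial.

(** * Triangular factorisation and leading minors *)

Section Gram.
Variables (C : numClosedFieldType) (n : nat).

(** {0, ..., i} has the least sum, so its column in the compound of h is zero off the diagonal and
    Cauchy-Binet leaves one term. *)
Lemma gram_ini_row (h : 'M[C]_n) (i : 'I_n.-1) T : upper_mx h ->
  extmx i.+1 (h^T *m h) (ext_ini i) T =
  extmx i.+1 h (ext_ini i) (ext_ini i) * extmx i.+1 h (ext_ini i) T.
Proof.
move=> uh; rewrite extmxM extmx_tr mxE (bigD1 (ext_ini i)) //= big1 ?addr0.
  by rewrite [in LHS]mxE.
move=> S Si; rewrite [_^T _ _]mxE.
have [->|/(extmx_upper_neq0 uh)[e|/ext_ini_min//]] := eqVneq (extmx i.+1 h S (ext_ini i)) 0.
  by rewrite mul0r.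
by rewrite e eqxx in Si.
Qed.

(** Rows 0..i and columns 0..i-1, j of h form a triangular block that differs from the leading one
    only in its last diagonal entry. The ratio of minors thus reads off an entry of h with rows
    scaled to unit diagonal. *)
Lemma ext_ini_last (h : 'M[C]_n) (i : 'I_n.-1) (r j : 'I_n) : upper_mx h ->
  val r = i -> (i <= j)%N -> h r r != 0 ->
  extmx i.+1 h (ext_ini i) (ext_last i j) =
  extmx i.+1 h (ext_ini i) (ext_ini i) * (h r j / h r r).
Proof.
move=> uh ri ij h0; rewrite extmx_upper_diag // [LHS]mxE -det_tr det_trig; last first.
  apply/is_trig_mxP => l m lm; rewrite !mxE uh //.
  rewrite ext_iniE ext_lastE //; have := ltn_ord m; rewrite ltnS => mi.
  by rewrite (leq_trans lm).
rewrite !big_ord_recr /= -mulrA; congr (_ * _).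
  apply: eq_bigr => l _; rewrite !mxE; congr (h _ _); apply: val_inj.
  by rewrite /= ext_iniE ext_lastE //= ltn_ord.
have er : ext_idx (ext_ini i) ord_max = r by apply: val_inj; rewrite /= ext_iniE ri.
have ej : ext_idx (ext_last i j) ord_max = j.
  by apply: val_inj; rewrite /= ext_lastE //= ltnn.
by rewrite !mxE er ej mulrCA mulfV // mulr1.
Qed.

(** In the Borel normal form of A, nonzero leading minors force s to preserve every initial segment,
    so [s r <= r]; an involution with this property is the identity. *)
Lemma gram_upper (A : 'M[C]_n) : A^T = A -> A \in unitmx ->
  (forall i : 'I_n.-1, extmx i.+1 A (ext_ini i) (ext_ini i) != 0) ->
  exists h, [/\ upper_mx h, h \in unitmx & A = h^T *m h].
Proof.
move=> As AU A0.
have [|s [ss _ [b [ub Ub _ E]]]] := @sym_borel_normal C n (fun=> 0%N) A As AU.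
  by [].
have Abt : A = (invmx b)^T *m perm_mx s *m invmx b.
  rewrite E !mulmxA -trmx_mul mulmxV // trmx1 mul1mx -mulmxA mulmxV //.
  by rewrite mulmx1.
have ubi := upper_inv Ub ub.
have sle (r : 'I_n) : (s r <= r)%N.
  have [rn|nr] := ltnP r n.-1; last first.
    by rewrite (leq_trans _ nr) // -ltnS prednK // (leq_ltn_trans _ (ltn_ord r)).
  pose i := Ordinal rn.
  have : extmx i.+1 (perm_mx s : 'M[C]_n) (ext_ini i) (ext_ini i) != 0.
    apply: contraNneq (A0 i) => e0.
    rewrite Abt !extmxM extmx_tr mxE (bigD1 (ext_ini i)) //= big1 ?addr0; last first.
      move=> S Si.
      have [->|/(extmx_upper_neq0 ubi)[e|/ext_ini_min//]] :=
        eqVneq (extmx i.+1 (invmx b) S (ext_ini i)) 0; first by rewrite mulr0.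
      by rewrite e eqxx in Si.
    rewrite mxE (bigD1 (ext_ini i)) //= e0 mulr0 add0r big1 ?mul0r // => S Si.
    rewrite [_^T _ _]mxE.
    have [->|/(extmx_upper_neq0 ubi)[e|/ext_ini_min//]] :=
        eqVneq (extmx i.+1 (invmx b) S (ext_ini i)) 0; first by rewrite mul0r.
    by rewrite e eqxx in Si.
  rewrite extmx_perm_neq0 => /eqP/setP/(_ (s r)).
  have -> : s r \in s @: ext_set (ext_ini i).
    rewrite imset_f //; apply/imsetP; exists ord_max => //; apply: val_inj.
    by rewrite /= ext_iniE.
  by case/imsetP => l _ ->; rewrite ext_iniE -ltnS.
have s1 : s = 1%g.
  apply/permP => r; rewrite perm1; apply: val_inj; apply/eqP.
  by rewrite eqn_leq sle -{1}[r]ss sle.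
exists (invmx b); split; rewrite ?unitmx_inv //.
by rewrite Abt s1 perm_mx1 mulmx1.
Qed.
End Gram.

Section Chart.
Variables (C : numClosedFieldType) (n : nat) (g : 'M[C]_n).
Hypothesis gU : g \in unitmx.
Local Notation tuples := (forall i : 'I_n.-1, 'M[C]_(ext_dim i.+1 n)).
Implicit Types (F G : tuples -> C) (v : tuples).

Definition tw v (i : 'I_n.-1) := (extmx i.+1 g)^T *m v i *m extmx i.+1 g.
Definition twl v i := tw v i (ext_ini i) (ext_ini i).
Definition in_chart v := forall i, twl v i != 0.

Lemma mhom_tw i S T : mhom (fun j => (i == j) : nat) (fun v => tw v i S T).
Proof.
apply: (@eq_mhom _ _ (fun j => (i == j) : nat) _ (fun v => \sum_T' \sum_S'
   (extmx i.+1 g S' S * extmx i.+1 g T' T) * v i S' T')) => //.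
  move=> v; rewrite /tw [RHS]mxE; apply: eq_bigr => T' _; rewrite [X in _ = X * _]mxE mulr_suml.
  by apply: eq_bigr => S' _; rewrite [_^T _ _]mxE mulrAC.
apply: mhom_sum => T' _; apply: mhom_sum => S' _; apply: mhomZ.
exact: mhom_coord.
Qed.

Lemma mhom_twl : mhom (fun=> 1%N) (fun v => \prod_i twl v i).
Proof.
apply: (@eq_mhom _ _ (fun j => \sum_i (i == j : nat))%N _ (fun v => \prod_i twl v i)) => //.
  by move=> j; rewrite (bigD1 j) //= eqxx big1 // => i /negPf ->.
apply: (@mhom_prod _ _ _ (fun i j => (i == j) : nat) (fun i v => twl v i)) => i.
exact: mhom_tw.
Qed.

(* Regular functions, of multidegree 0, on the chart. *)
Definition reg F := exists N G, mhom (fun=> N) G /\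
  forall v, in_chart v -> F v * (\prod_i twl v i) ^+ N = G v.

Lemma reg_const c : reg (fun=> c).
Proof.
exists 0%N, (fun=> c * 1); split; last by move=> v _; rewrite expr0.
by apply: mhomZ; apply: mhom1.
Qed.

Lemma mhom_twlX N : mhom (fun=> N) (fun v => (\prod_i twl v i) ^+ N).
Proof. by apply: eq_mhom (mhomX N mhom_twl) => // j; rewrite muln1. Qed.

Lemma regD F G : reg F -> reg G -> reg (fun v => F v + G v).
Proof.
move=> [N [F' [hF FE]]] [M [G' [hG GE]]]; exists (N + M)%N.
exists (fun v => F' v * (\prod_i twl v i) ^+ M + (\prod_i twl v i) ^+ N * G' v).
split; first by apply: mhomD; apply: mhomM => //; apply: mhom_twlX.
by move=> v cv; rewrite -FE // -GE // exprD; ring.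
Qed.

Lemma regM F G : reg F -> reg G -> reg (fun v => F v * G v).
Proof.
move=> [N [F' [hF FE]]] [M [G' [hG GE]]]; exists (N + M)%N.
exists (fun v => F' v * G' v); split; first exact: mhomM.
by move=> v cv; rewrite -FE // -GE // exprD; ring.
Qed.

Lemma eq_reg F G : F =1 G -> reg F -> reg G.
Proof.
move=> FG [N [F' [hF FE]]]; exists N, F'; split=> // v cv.
by rewrite -FG FE.
Qed.

Lemma reg_sum (I : Type) (s : seq I) (P : pred I) (F : I -> tuples -> C) :
  (forall i, reg (F i)) -> reg (fun v => \sum_(i <- s | P i) F i v).
Proof.
move=> H; elim: s => [|i s IH].
  by apply: eq_reg (reg_const 0) => v; rewrite big_nil.
have [Pi|/negPf nPi] := boolP (P i).
  by apply: eq_reg (regD (H i) IH) => v; rewrite big_cons Pi.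
by apply: eq_reg IH => v; rewrite big_cons nPi.
Qed.

Lemma reg_prod (I : Type) (s : seq I) (P : pred I) (F : I -> tuples -> C) :
  (forall i, reg (F i)) -> reg (fun v => \prod_(i <- s | P i) F i v).
Proof.
move=> H; elim: s => [|i s IH].
  by apply: eq_reg (reg_const 1) => v; rewrite big_nil.
have [Pi|/negPf nPi] := boolP (P i).
  by apply: eq_reg (regM (H i) IH) => v; rewrite big_cons Pi.
by apply: eq_reg IH => v; rewrite big_cons nPi.
Qed.

Lemma reg_det m (M : tuples -> 'M[C]_m) :
  (forall i j, reg (fun v => M v i j)) -> reg (fun v => \det (M v)).
Proof.
move=> H; apply: reg_sum => s; apply: regM; first exact: reg_const.
by apply: reg_prod => i; apply: H.
Qed.

Lemma reg_ratio i S T : reg (fun v => tw v i S T / twl v i).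
Proof.
(* The other leading entries are multiplied in to reach the common denominator. *)
exists 1%N, (fun v => tw v i S T * \prod_j (if j == i then 1 else twl v j)); split.
  apply: (@eq_mhom _ _ (fun j => (i == j) + \sum_l (if l == i then 0 else l == j : nat))%N
     _ (fun v => tw v i S T * \prod_j (if j == i then 1 else twl v j))) => //.
    move=> j; rewrite (bigD1 i) //= eqxx add0n; have [<-|ij] := eqVneq i j.
      by rewrite big1 // => l /negPf li; rewrite li.
    rewrite (bigD1 j) //=; last by rewrite eq_sym.
    by rewrite eq_sym (negPf ij) eqxx big1 // => l /andP[/negPf -> /negPf ->].
  apply: mhomM; first exact: mhom_tw.
  apply: (@mhom_prod _ _ _ (fun l j => if l == i then 0%N else (l == j : nat))).
  by move=> j; case: (eqVneq j i) => _; [apply: mhom1|apply: mhom_tw].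
move=> v cv; rewrite expr1 (bigD1 i) //= [in RHS](bigD1 i) //= eqxx mul1r.
rewrite mulrA divfK //; congr (_ * _).
by apply: eq_bigr => j /negPf ->.
Qed.

(** Clearing denominators gives a multihomogeneous G; one more factor, the product of the leading
    entries, takes care of the nondegenerate points outside the chart. *)
Lemma reg_vanish F x v : reg F ->
  (forall (A : 'M[C]_n) (c : 'I_n.-1 -> C), A^T = A -> A \in unitmx ->
     (forall i, c i != 0) -> in_chart (fun i => c i *: extmx i.+1 A) ->
     F (fun i => c i *: extmx i.+1 A) = 0) ->
  complete_quadrics C n x -> represents v x -> in_chart v -> F v = 0.
Proof.
move=> [N [G [hG GE]]] H clx xv cv.
suff : G v * \prod_i twl v i = 0.
  move/eqP; rewrite -GE // -mulrA mulf_eq0 => /orP[/eqP//|].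
  have P0 : \prod_i twl v i != 0 by apply/prodf_neq0 => i _.
  by rewrite mulf_eq0 expf_eq0 (negPf P0) andbF.
apply: (closure_vanish (mhomM hG mhom_twl) _ clx xv) => A c As AU c0.
have [cA|] := boolP [forall i, twl (fun i => c i *: extmx i.+1 A) i != 0].
  have {}cA : in_chart (fun i => c i *: extmx i.+1 A) by move=> i; apply: (forallP cA).
  by rewrite -GE // H // !mul0r.
rewrite negb_forall => /existsP[i hi]; rewrite negbK in hi.
by rewrite (bigD1 i) //= (eqP hi) mul0r mulr0.
Qed.

(* At a nondegenerate A with g^T A g = h^T h and h upper triangular, chartU is h with
   its rows scaled to have unit diagonal. *)
Definition chartU v : 'M[C]_n := \matrix_(r, j)
  if (j < r)%N then 0 else if j == r then 1 else
  if (insub (val r) : option 'I_n.-1) is Some i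
  then tw v i (ext_ini i) (ext_last i j) / twl v i else 0.

Lemma reg_chartU r j : reg (fun v => chartU v r j).
Proof.
apply: (@eq_reg (fun v => if (j < r)%N then 0 else if j == r then 1 else
  if (insub (val r) : option 'I_n.-1) is Some i
  then tw v i (ext_ini i) (ext_last i j) / twl v i else 0)).
  by move=> v; rewrite mxE.
case: (j < r)%N; first exact: reg_const.
case: (j == r); first exact: reg_const.
by case: (insub (val r)) => [i|]; [apply: reg_ratio|apply: reg_const].
Qed.

Lemma chartU_upper v : upper_mx (chartU v).
Proof. by move=> i j ij; rewrite mxE ij. Qed.

Lemma chartU_det v : \det (chartU v) = 1.
Proof. by rewrite upper_det ?big1 // => [i _|]; [rewrite mxE ltnn eqxx|apply: chartU_upper]. Qed.

(** The inverse of [chartU], written as the adjugate so that its entries are polynomial in those of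
    [chartU]. *)
Definition chartV v := \adj (chartU v).

Lemma chartUV v : chartU v *m chartV v = 1%:M.
Proof. by rewrite mul_mx_adj chartU_det. Qed.

Lemma reg_chartV i j : reg (fun v => chartV v i j).
Proof.
apply: (@eq_reg (fun v => (-1) ^+ (j + i) * \det (row' j (col' i (chartU v))))).
  by move=> v; rewrite mxE.
apply: regM; first exact: reg_const.
apply: reg_det => r s; apply: eq_reg (reg_chartU (lift j r) (lift i s)) => v.
by rewrite !mxE.
Qed.

Lemma reg_ext_chartV k S T : reg (fun v => extmx k (chartV v) S T).
Proof.
apply: (@eq_reg (fun v => \det (mxsub (ext_idx S) (ext_idx T) (chartV v)))).
  by move=> v; rewrite mxE.
apply: reg_det => r s; apply: eq_reg (reg_chartV (ext_idx S r) (ext_idx T s)) => v.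
by rewrite [RHS]mxE.
Qed.

(** What remains after U is removed from both sides: for g^T A g = U^T D U, the compound of D
    divided by its leading entry. *)
Definition chartN v (i : 'I_n.-1) : 'M[C]_(ext_dim i.+1 n) :=
  (twl v i)^-1 *: ((extmx i.+1 (chartV v))^T *m tw v i *m extmx i.+1 (chartV v)).

Lemma reg_chartN i S T : reg (fun v => chartN v i S T).
Proof.
apply: (@eq_reg (fun v => \sum_T' (\sum_S' extmx i.+1 (chartV v) S' S *
   (tw v i S' T' / twl v i)) * extmx i.+1 (chartV v) T' T)).
  move=> v; rewrite [RHS]mxE [X in _ = _ * X]mxE mulr_sumr; apply: eq_bigr => T' _.
  rewrite [in RHS]mxE mulrA; congr (_ * _); rewrite mulr_sumr; apply: eq_bigr => S' _.
  by rewrite [_^T _ _]mxE mulrA mulrC.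
apply: reg_sum => T'; apply: regM; last exact: reg_ext_chartV.
apply: reg_sum => S'; apply: regM; first exact: reg_ext_chartV.
exact: reg_ratio.
Qed.

Lemma tw_chartN v i : in_chart v ->
  tw v i = twl v i *: ((extmx i.+1 (chartU v))^T *m chartN v i *m extmx i.+1 (chartU v)).
Proof.
move=> cv; have VU : chartV v *m chartU v = 1%:M by apply: mulmx1C (chartUV v).
have E (W : 'M[C]_(ext_dim i.+1 n)) : (extmx i.+1 (chartU v))^T *m
    ((extmx i.+1 (chartV v))^T *m W *m extmx i.+1 (chartV v)) *m extmx i.+1 (chartU v) = W.
  rewrite !mulmxA -trmx_mul -extmxM VU extmx1 trmx1 mul1mx -mulmxA -extmxM VU extmx1.
  by rewrite mulmx1.
by rewrite /chartN -scalemxAr -scalemxAl scalerA mulfV // scale1r E.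
Qed.

(** For g^T A g = h^T h the ratios in [chartU] recover h with its diagonal divided out of the rows;
    the squares of that diagonal are the d. *)
Lemma nondegenerate_chart (A : 'M[C]_n) (c : 'I_n.-1 -> C) :
  A^T = A -> A \in unitmx -> in_chart (fun i => c i *: extmx i.+1 A) ->
  exists d : 'I_n -> C, (forall r, d r != 0) /\ forall i S T,
    chartN (fun i => c i *: extmx i.+1 A) i S T =
    if S == T then \prod_l (d (ext_idx S l) / d (ext_idx (ext_ini i) l)) else 0.
Proof.
move=> As AU cA; set v : tuples := fun i : 'I_n.-1 => c i *: extmx i.+1 A.
pose A' := g^T *m A *m g.
have twE i : tw v i = c i *: extmx i.+1 A'.
  by rewrite /tw /v -scalemxAr -scalemxAl /A' !extmxM extmx_tr.
have c0 i : c i != 0.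
  by apply: contraNneq (cA i) => e0; rewrite /twl twE e0 scale0r mxE.
have [|||h [uh Uh hE]] := @gram_upper C n A'.
- by rewrite /A' !trmx_mul trmxK As mulmxA.
- by rewrite /A' !unitmx_mul unitmx_tr gU AU.
- by move=> i; apply: contraNneq (cA i) => e0; rewrite /twl twE mxE e0 mulr0.
have /(upper_unitP uh) h0 := Uh.
have lE i : twl v i = c i * extmx i.+1 h (ext_ini i) (ext_ini i) ^+ 2.
  by rewrite /twl twE mxE hE gram_ini_row // expr2.
have hi0 (i : 'I_n.-1) S : extmx i.+1 h S S != 0.
  by rewrite extmx_upper_diag //; apply/prodf_neq0 => l _.
pose D : 'M[C]_n := diag_mx (\row_r h r r).
have hDU : h = D *m chartU v.
  apply/matrixP => r j; rewrite mul_diag_mx !mxE; case: (ltngtP j r) => [jr|rj|e].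
  - by rewrite uh // mulr0.
  - case: insubP => [i _ ir|/negP[]]; last by have := ltn_ord j; rewrite /=; lia.
    rewrite -val_eqE gtn_eqF // twE mxE hE gram_ini_row // lE (@ext_ini_last C n h i r j) //.
      by have := hi0 i (ext_ini i); have := c0 i; have := h0 r => ? ? ?; field; apply/and3P; split.
    by rewrite ir ltnW.
  - by move/val_inj: e => ->; rewrite eqxx mulr1.
exists (fun r => h r r ^+ 2); split; first by move=> r; rewrite expf_neq0.
move=> i S T.
have -> : chartN v i = (twl v i)^-1 *: (c i *: extmx i.+1 (D *m D)).
  rewrite /chartN twE hE; congr (_ *: _); rewrite -scalemxAr -scalemxAl; congr (_ *: _).
  rewrite -extmx_tr -!extmxM; congr extmx; rewrite [in LHS]hDU trmx_mul tr_diag_mx -/D.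
  by rewrite !mulmxA -trmx_mul chartUV trmx1 mul1mx -!mulmxA chartUV mulmx1.
rewrite mulmx_diag extmx_diag scalerA lE [LHS]mxE [X in _ * X]mxE [X in _ * (X *+ _)]mxE.
case: (eqVneq S T) => _; last by rewrite mulr0n mulr0.
rewrite mulr1n invfM [_ * c i]mulrAC mulVf // mul1r extmx_upper_diag // -prodrXl -prodfV -big_split /=.
by apply: eq_bigr => l _; rewrite !mxE mulrC -expr2.
Qed.
End Chart.

Section ChartDiagonal.
Variables (C : numClosedFieldType) (n : nat) (g : 'M[C]_n).
Local Notation tuples := (forall i : 'I_n.-1, 'M[C]_(ext_dim i.+1 n)).

Lemma ord_succ_lt (i : 'I_n.-1) : (i.+1 < n)%N.
Proof. by have := ltn_ord i; lia. Qed.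

(** The subset {0, ..., i - 1, i + 1}: its normalised minor is d_(i+1)/d_i. *)
Definition ext_next (i : 'I_n.-1) := ext_last i (Ordinal (ord_succ_lt i)).

Definition chartz (v : tuples) (m : nat) : C :=
  if (insub m : option 'I_n.-1) is Some i then chartN g v i (ext_next i) (ext_next i) else 1.

Lemma reg_chartz m : reg g (fun v => chartz v m).
Proof.
by rewrite /chartz; case: (insub m) => [i|]; [apply: reg_chartN|apply: reg_const].
Qed.

Hypothesis gU : g \in unitmx.

(** With l <= S_l, the quotient of d at S_l by d at l telescopes into consecutive ratios. *)
Lemma nondegenerate_chartz (A : 'M[C]_n) (c : 'I_n.-1 -> C) :
  A^T = A -> A \in unitmx -> in_chart g (fun i => c i *: extmx i.+1 A) ->
  forall i S T, chartN g (fun i => c i *: extmx i.+1 A) i S T =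
    if S == T then \prod_(l < i.+1) \prod_(l <= m < ext_idx S l)
      chartz (fun i => c i *: extmx i.+1 A) m else 0.
Proof.
move=> As AU cA; have [d [d0 dE]] := nondegenerate_chart gU As AU cA.
pose dn (m : nat) : C := if (insub m : option 'I_n) is Some r then d r else 1.
have dnE (r : 'I_n) : dn r = d r by rewrite /dn valK.
have dn0 m : dn m != 0 by rewrite /dn; case: insub => [r|]; rewrite ?d0 ?oner_neq0.
have zE m : (m < n.-1)%N -> chartz (fun i => c i *: extmx i.+1 A) m = dn m.+1 / dn m.
  move=> mn; rewrite /chartz insubT dE eqxx big_ord_recr /= big1 ?mul1r => [|l _].
    rewrite -!dnE ext_iniE ext_lastE //= ltnn //.
  by rewrite -!dnE ext_iniE ext_lastE //= ltn_ord divff.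
move=> i S T; rewrite dE; case: (eqVneq S T) => // _.
apply: eq_bigr => l _; rewrite -!dnE ext_iniE.
rewrite (eq_big_nat _ _ (F2 := fun m => dn m.+1 / dn m)).
  have := ext_idx_ge S l; rewrite leq_eqVlt => /orP[/eqP <-|lS].
    by rewrite big_geq // divff.
  by rewrite telescope_prodf.
move=> m /andP[_ mS]; apply: zE; have := ltn_ord (ext_idx S l); lia.
Qed.

(** Both sides are regular on the chart and agree at nondegenerate points, so the identity extends
    to the closure, where some z_m may be 0. *)
Lemma chartN_diag x v : complete_quadrics C n x -> represents v x -> in_chart g v ->
  forall i S T, chartN g v i S T =
    if S == T then \prod_(l < i.+1) \prod_(l <= m < ext_idx S l) chartz v m else 0.
Proof.
move=> clx xv cv i S T.
pose F (w : tuples) := chartN g w i S T + -1 *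
   (if S == T then \prod_(l < i.+1) \prod_(l <= m < ext_idx S l) chartz w m else 0).
suff : F v = 0 by rewrite /F mulN1r => /eqP; rewrite subr_eq0 => /eqP.
apply: (@reg_vanish _ _ g F x v) => //.
  apply: regD; first exact: reg_chartN.
  apply: regM; first exact: reg_const.
  case: (S == T); last exact: reg_const.
  apply: reg_prod => l; apply: reg_prod => m; exact: reg_chartz.
move=> A c As AU c0 cA; rewrite /F nondegenerate_chartz //.
by rewrite mulN1r subrr.
Qed.
End ChartDiagonal.

(** * From vanishing ratios to levels *)

Section MonomialLead.
Variables (C : numClosedFieldType) (n : nat) (z : nat -> C).

(** Replacing each vanishing z_j by t turns z_0 ... z_(m-1) into [zunit m] times t to the power
    [zlevel m]. *)
Definition zlevel (m : nat) : nat := (\sum_(0 <= j < m) (z j == 0%R))%N.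
Definition zunit (m : nat) : C := \prod_(0 <= j < m) (if z j == 0 then 1 else z j).

Lemma zunit_neq0 m : zunit m != 0.
Proof.
by rewrite /zunit big_mkord; apply/prodf_neq0 => j _; case: ifP => [_|/negbT//]; apply: oner_neq0.
Qed.

Lemma zlevel_le l m : (l <= m)%N -> (zlevel l <= zlevel m)%N.
Proof. by move=> lm; rewrite /zlevel (big_cat_nat (leq0n l) lm) //= leq_addr. Qed.

Lemma zlevel_bound m : (zlevel m <= m)%N.
Proof.
rewrite -[X in (_ <= X)%N]subn0 -[X in (_ <= X)%N]muln1 -sum_nat_const_nat.
by apply: leq_sum => j _; case: eqP.
Qed.

Lemma zlevel_initial m v : (v < zlevel m)%N -> exists2 j, (j < m)%N & zlevel j = v.
Proof.
elim: m => [|m IH]; first by rewrite /zlevel big_geq.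
rewrite {1}/zlevel big_nat_recr //= -/(zlevel m) => vm.
have [/IH[j jm jv]|mv] := ltnP v (zlevel m); first by exists j => //; apply: ltnW.
by exists m => //; apply/eqP; rewrite eqn_leq mv /=; case: eqP vm => _; rewrite ?addn1 ?addn0 //; lia.
Qed.

Lemma zprod_range l m : (l <= m)%N -> \prod_(l <= j < m) z j =
  if zlevel l == zlevel m then zunit m / zunit l else 0.
Proof.
move=> lm.
have lE : (zlevel m = zlevel l + \sum_(l <= j < m) (z j == 0%R))%N.
  by rewrite /zlevel (big_cat_nat (leq0n l) lm).
have uE : zunit m = zunit l * \prod_(l <= j < m) (if z j == 0 then 1 else z j).
  by rewrite /zunit (big_cat_nat (leq0n l) lm).
rewrite lE -{1}[zlevel l]addn0 eqn_add2l eq_sym uE mulrAC mulfV ?zunit_neq0 // mul1r.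
rewrite sum_nat_seq_eq0; case: allP => [H|H].
  rewrite !big_seq; apply: eq_bigr => j jlm; have := H j jlm.
  by rewrite /=; case: (z j == 0).
apply/eqP/negPn/negP => nz; apply: H => j jlm /=; rewrite eqb0.
by apply: contraNneq nz => zj; rewrite prodf_seq_eq0; apply/hasP; exists j => //=; rewrite zj eqxx.
Qed.

(** As [zlevel] is monotone and l <= S_l, the entry at S is nonzero iff S has the levels of {0, ...,
    i} position by position, that is, minimal weight. The scalar c makes the entry at {0, ..., i}
    equal to 1. *)
Lemma monomial_lead (i : 'I_n.-1) (N : 'M[C]_(ext_dim i.+1 n)) :
  (forall S T, N S T = if S == T
     then \prod_(l < i.+1) \prod_(l <= m < ext_idx S l) z m else 0) ->
  exists2 c, c != 0 &
    N = c *: lead i.+1 (fun r : 'I_n => zlevel r) (diag_mx (\row_(r < n) zunit r)).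
Proof.
move=> NE; exists (\prod_(l < i.+1) zunit l)^-1.
  by rewrite invr_eq0; apply/prodf_neq0 => l _; apply: zunit_neq0.
apply/matrixP => S T.
have dE : extmx i.+1 (diag_mx (\row_(r < n) zunit r)) S T =
    (\prod_l zunit (ext_idx S l)) *+ (S == T).
  by rewrite extmx_diag !mxE; congr (_ *+ _); apply: eq_bigr => l _; rewrite mxE.
rewrite NE [RHS]mxE [X in _ = _ * X]mxE dE.
have [<-|ST] := eqVneq S T; last by rewrite mulr0n if_same mulr0.
rewrite mulr1n andbb.
have le (b : 'I_(ext_dim i.+1 n)) (l : 'I_i.+1) : (zlevel l <= zlevel (ext_idx b l))%N.
  exact: zlevel_le (ext_idx_ge _ _).
have [/forallP H|] := boolP [forall l : 'I_i.+1, zlevel l == zlevel (ext_idx S l)].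
  have -> : wmin (fun r : 'I_n => zlevel r) S.
    apply/wminP => b; rewrite /ext_wt; apply: leq_sum => l _.
    by rewrite -(eqP (H l)).
  rewrite -prodfV -big_split /=; apply: eq_bigr => l _.
  by rewrite zprod_range ?ext_idx_ge // H mulrC.
rewrite negb_forall => /existsP[l0 hl0].
have -> : wmin (fun r : 'I_n => zlevel r) S = false.
  apply/negP => /wminP/(_ (ext_ini i)); rewrite /ext_wt leqNgt => /negP; apply.
  rewrite (bigD1 l0) //= [X in (_ < X)%N](bigD1 l0) //= -addSn leq_add //.
    by rewrite ext_iniE ltn_neqAle hl0 le.
  by apply: leq_sum => l _; rewrite ext_iniE le.
by rewrite mulr0 (bigD1 l0) //= zprod_range ?ext_idx_ge // (negPf hl0) mul0r.
Qed.
End MonomialLead.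

(** * Reduction of a point to normal form *)

Section Normal.
Variables (C : numClosedFieldType) (n : nat).

Lemma closure_lead (x : ambient C n) : complete_quadrics C n x ->
  exists (z : nat -> C) (G : 'M[C]_n), G \in unitmx /\
   represents (fun i => (extmx i.+1 G)^T *m
     lead i.+1 (fun r : 'I_n => zlevel z r) (diag_mx (\row_(r < n) zunit z r)) *m
     extmx i.+1 G) x.
Proof.
move=> clx; have [v xv] := represents_exists x.
have [g gU cv] := generic_point (@ext_ini n) clx xv.
have UU : chartU g v \in unitmx by rewrite unitmxE chartU_det unitr1.
exists (chartz g v), (chartU g v *m invmx g).
split; first by rewrite unitmx_mul UU unitmx_inv.
move=> i; rewrite xv.
have [c c0 NE] := monomial_lead (chartN_diag gU clx xv cv (i := i)).
have vE : v i = (extmx i.+1 (invmx g))^T *m tw g v i *m extmx i.+1 (invmx g).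
  have : tw g v i = (extmx i.+1 g)^T *m v i *m extmx i.+1 g by [].
  move: (tw g v i) => W ->.
  rewrite !mulmxA -trmx_mul -extmxM mulmxV // extmx1 trmx1 mul1mx -mulmxA -extmxM.
  by rewrite mulmxV // extmx1 mulmx1.
rewrite vE (tw_chartN _ cv) NE extmxM trmx_mul -!scalemxAr -!scalemxAl -scalemxAr -scalemxAl.
by rewrite !mulmxA scalerA line_scale // mulf_neq0 //; apply: cv.
Qed.

Lemma closure_normal (n0 : (0 < n)%N) (x : ambient C n) : complete_quadrics C n x ->
  exists (f : 'I_n -> nat) (s : 'S_n) y,
  [/\ forall i, (f i < n)%N, initial_levels f, forall i, s (s i) = i, forall i, f (s i) = f i &
     represents (fun i => lead i.+1 f (perm_mx s : 'M[C]_n)) y /\ borel_orbit x y].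
Proof.
move=> clx; have [z [G [GU xG]]] := closure_lead clx.
set f0 := fun r : 'I_n => zlevel z r in xG.
set D := diag_mx _ in xG.
(* Column j of [G *m b] receives the level of its top row [rho j]; since [zlevel] is monotone, X is
   then filtered. *)
have [b [rho [ub Ub rI gb0 gbr]]] := column_tops GU.
pose f r := f0 (rho r); pose X := G *m b.
have hX i j : X i j != 0 -> (f j <= f0 i)%N by move=> /gbr h; apply: zlevel_le.
pose X' := level_part f f0 X; pose A := X'^T *m D *m X'.
have LA k : (extmx k X)^T *m lead k f0 D *m extmx k X = lead k f A.
  exact: (lead_mul k D rI _ hX).
have X'X i j : X' i j != 0 -> X i j != 0.
  by rewrite {1}/X' mxE; case: ifP => // _; rewrite eqxx.
have X'r j : X' (rho j) j != 0 by rewrite /X' mxE /f eqxx; apply: gb0.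
have X'f i j : X' i j != 0 -> f j = f0 i.
  by rewrite /X' mxE; case: ifP => [/eqP //|_]; rewrite eqxx.
(* Reordering the columns by the inverse of rho makes the graded part triangular with nonzero
   diagonal. *)
have X'U : X' \in unitmx.
  pose Y : 'M[C]_n := \matrix_(i, j) X' i (invF rI j).
  have YE : Y = X' *m (\matrix_(i, j) (i == invF rI j)%:R).
    apply/matrixP => i j; rewrite mxE [RHS]mxE (bigD1 (invF rI j)) //= big1 ?addr0.
      by rewrite [X in _ = _ * X]mxE eqxx mulr1.
    by move=> l /negPf lj; rewrite [X in _ * X]mxE lj mulr0.
  suff : Y^T \in unitmx by rewrite unitmx_tr YE unitmx_mul => /andP[].
  have uY : upper_mx Y^T.
    move=> i j ij; rewrite mxE mxE; apply/eqP/negPn/negP => /X'X/gbr.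
    by rewrite f_invF leqNgt ij.
  apply/(upper_unitP uY) => i; rewrite mxE mxE.
  by have := X'r (invF rI i); rewrite f_invF.
have DU : D \in unitmx.
  apply/upper_unitP; first by move=> i j ij; rewrite !mxE -val_eqE gtn_eqF.
  by move=> i; rewrite !mxE eqxx mulr1n zunit_neq0.
have As : A^T = A by rewrite /A !trmx_mul trmxK tr_diag_mx mulmxA.
have AU : A \in unitmx by rewrite /A !unitmx_mul unitmx_tr X'U DU.
have Al : level_mx f A.
  move=> i j nz.
  have : exists r, [/\ X' r i != 0 & X' r j != 0].
    apply: contrapT => /forallNP H; case/eqP: nz; rewrite mxE big1 // => r _.
    rewrite /D mul_mx_diag mxE [X'^T _ _]mxE.
    have [->|n1] := eqVneq (X' r i) 0; first by rewrite !mul0r.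
    have [->|n2] := eqVneq (X' r j) 0; first by rewrite mulr0.
    by case: (H r).
  by move=> [r [/X'f -> /X'f ->]].
have [s [ss fs [c [uc Uc lc cE]]]] := sym_borel_normal As AU Al.
exists f, s.
have vs (i : 'I_n.-1) := @lead_perm_tr C n i.+1 f s ss.
have v0 (i : 'I_n.-1) := @lead_perm_nonzero C n i.+1 f s fs (ext_lt i).
have [y yE] := point_exists vs v0.
exists y; split => //.
- by move=> i; rewrite /f /f0 (leq_ltn_trans (zlevel_bound _ _)).
- move=> i m; rewrite /f /f0 => /zlevel_initial[j jr jm].
  have jn : (j < n)%N by rewrite (ltn_trans jr).
  by exists (invF rI (Ordinal jn)); rewrite f_invF.
split => //; apply/(borel_orbitP n0 xG yE).
exists (b *m c); split; [exact: upper_mxM|by rewrite unitmx_mul Ub|].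
move=> i; rewrite cE -(lead_mul_level i.+1 A lc) -LA !extmxM !trmx_mul.
by rewrite !mulmxA.
Qed.
End Normal.

(** * Counting *)

Section HPolynomials.

Let F := H_gen.

Lemma H_genE : F = 'X * (('X : {poly rat})%:P * (1 + (2%:R^-1)%:P%:P * 'X)).
Proof. by rewrite /F /H_gen expr2; ring. Qed.

Lemma H_gen_coef0 m k : (k < m)%N -> (F ^+ m)`_k = 0.
Proof. by move=> km; rewrite H_genE exprMn coefXnM km. Qed.

Lemma exp_coef_widen m k : (k < m)%N ->
  exp_coef F k = \sum_(i < m) (i`!%:R)^-1 *: (F ^+ i)`_k.
Proof.
move=> km; rewrite /exp_coef (big_ord_widen _ (fun i => (i`!%:R)^-1 *: (F ^+ i)`_k) km).
rewrite [RHS](bigID (fun i : 'I_m => (i < k.+1)%N)) /= [X in _ + X]big1 ?addr0 //.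
by move=> i; rewrite -leqNgt => /H_gen_coef0 ->; rewrite scaler0.
Qed.

Lemma H_gen_deriv : F^`() = ('X : {poly rat})%:P * (1 + 'X).
Proof.
rewrite /F /H_gen derivM derivC mul0r add0r; congr (_ * _).
rewrite derivD derivX derivM derivC mul0r add0r derivXn expr1 mulrnAr -mulrnAl.
have two : 2%:R^-1 *+ 2 = 1 :> rat by rewrite -[LHS]mulr_natr mulVf ?pnatr_eq0.
rewrite -!polyCMn two.
by rewrite !polyC1 mul1r.
Qed.

(** The coefficient of x^k in (e^F)' = F' e^F, where F' = y (1 + x), obtained on each power of F
    separately. *)
Lemma exp_coefS k : (k.+1)%:R *: exp_coef F k.+1 =
  'X * (exp_coef F k + if k is k'.+1 then exp_coef F k' else 0).
Proof.
have coefS m j : (F ^+ m.+1)`_j.+1 *+ j.+1 =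
    ('X * ((F ^+ m)`_j + if j is j'.+1 then (F ^+ m)`_j' else 0)) *+ m.+1.
  rewrite -coef_deriv deriv_exp /= H_gen_deriv coefMn -mulrA coefCM mulrDl mul1r coefD.
  by congr (_ * (_ + _) *+ _); rewrite coefXM; case: j.
rewrite {1}/exp_coef big_ord_recl expr0 coef1 scaler0 add0r scaler_sumr.
have -> : (if k is k'.+1 then exp_coef F k' else 0) =
   \sum_(i < k.+1) (i`!%:R)^-1 *: (if k is k'.+1 then (F ^+ i)`_k' else 0).
  case: k => [|k]; last by apply: exp_coef_widen; apply: leqW.
  by rewrite big1 // => i _; rewrite scaler0.
rewrite [exp_coef F k]/exp_coef -big_split mulr_sumr /=; apply: eq_bigr => i _.
rewrite -scalerDr /bump /= add1n scalerA mulrC -scalerA scaler_nat coefS.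
rewrite -scaler_nat scalerA factS natrM invfM mulrAC mulVf ?pnatr_eq0 // mul1r.
by rewrite scalerAr.
Qed.

Lemma Hpoly0 : Hpoly 0 = 1.
Proof. by rewrite /Hpoly /exp_coef big_ord1 expr0 coef1 fact0 invr1 !scale1r. Qed.

(** At k = 0 the factor k cancels the term with the truncated index [k.-1]. *)
Lemma HpolyS k : Hpoly k.+1 = 'X * (Hpoly k + k%:R *: Hpoly k.-1).
Proof.
rewrite {1}/Hpoly factS mulnC natrM -scalerA exp_coefS scalerAr scalerDr; congr (_ * (_ + _)).
case: k => [|k]; first by rewrite scaler0 scale0r.
by rewrite /Hpoly scalerA factS natrM.
Qed.
End HPolynomials.

(** * Involutions with coloured cycles *)

Section CountColoured.
Variables (T V : finType) (v0 : V) (K : {set V}).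
Implicit Types (D : {set T}) (x y : T).

(* Points outside D are fixed and get the dummy colour v0, so that the pairs can be
   counted by recursion on D. *)
Definition coloured D := [set p : {ffun T -> V} * {perm T} |
  [forall i, p.2 (p.2 i) == i] && [forall i, p.1 (p.2 i) == p.1 i] &&
  [forall i, if i \in D then p.1 i \in K else (p.2 i == i) && (p.1 i == v0)]].

Lemma colouredP D (f : {ffun T -> V}) (s : {perm T}) :
  reflect [/\ forall i, s (s i) = i, forall i, f (s i) = f i,
    forall i, i \in D -> f i \in K & forall i, i \notin D -> s i = i /\ f i = v0]
  ((f, s) \in coloured D).
Proof.
rewrite inE; apply: (iffP andP) => [[/andP[/forallP h1 /forallP h2] /forallP h3]|[h1 h2 h3 h4]].
  split=> i; try exact/eqP.
    by move=> iD; have := h3 i; rewrite iD.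
  by move=> /negPf iD; have := h3 i; rewrite iD => /andP[/eqP -> /eqP ->].
split; first by apply/andP; split; apply/forallP => i; apply/eqP; rewrite /= ?h1 ?h2.
apply/forallP => i; case: ifP => [/h3//|/negbT/h4[/= -> ->]].
by rewrite !eqxx.
Qed.

(** The cycle {x, y} takes one colour from K, and multiplying s by the transposition of x and y
    detaches it from the rest. The case y = x is included, with a trivial transposition. *)
Lemma card_coloured_fiber D x y : x \in D -> y \in D ->
  #|[set p in coloured D | p.2 x == y]| = (#|K| * #|coloured (D :\ x :\ y)|)%N.
Proof.
move=> xD yD; rewrite -cardsX.
pose psi (q : V * ({ffun T -> V} * {perm T})) : {ffun T -> V} * {perm T} :=
  ([ffun i => if (i == x) || (i == y) then q.1 else q.2.1 i], (q.2.2 * tperm x y)%g).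
have sE (s : {perm T}) i : s x = x -> s y = y ->
    (s * tperm x y)%g i = if i == x then y else if i == y then x else s i.
  move=> sx sy; rewrite permM; case: (eqVneq i x) => [->|ix]; first by rewrite sx tpermL.
  case: (eqVneq i y) => [->|iy]; first by rewrite sy tpermR.
  rewrite tpermD //; first by apply: contraNneq ix => e; apply/eqP/(@perm_inj _ s); rewrite sx.
  by apply: contraNneq iy => e; apply/eqP/(@perm_inj _ s); rewrite sy.
rewrite -[RHS](@card_in_imset _ _ psi); last first.
  move=> [k1 [f1 s1]] [k2 [f2 s2]]; rewrite !inE /= => /andP[_ h1] /andP[_ h2] [/ffunP ef es].
  have /colouredP[_ _ _ o1] : (f1, s1) \in coloured (D :\ x :\ y) by rewrite inE.
  have /colouredP[_ _ _ o2] : (f2, s2) \in coloured (D :\ x :\ y) by rewrite inE.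
  have -> : s1 = s2 by apply: (mulIg (tperm x y)).
  have -> : k1 = k2 by have := ef x; rewrite !ffunE eqxx.
  congr (_, (_, _)); apply/ffunP => i; have := ef i; rewrite !ffunE.
  case: ifP => // xy _; rewrite (o1 i _).2 ?(o2 i _).2 // !inE.
    by case/orP: xy => ->; rewrite ?andbF.
  by case/orP: xy => ->; rewrite ?andbF.
congr #|pred_of_set _|; apply/setP => -[f s]; apply/idP/imsetP.
  rewrite inE => /andP[/colouredP[ss fs fK out] /eqP /= sx].
  have sy : s y = x by rewrite -sx ss.
  pose f' : {ffun T -> V} := [ffun i => if (i == x) || (i == y) then v0 else f i].
  pose s' := (s * tperm x y)%g.
  have s'E i : s' i = if (i == x) || (i == y) then i else s i.
    rewrite permM; case: (eqVneq i x) => [->|ix] /=; first by rewrite sx tpermR.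
    case: (eqVneq i y) => [->|iy] /=; first by rewrite sy tpermL.
    rewrite tpermD //; first by apply: contraNneq iy => e; apply/eqP/(@perm_inj _ s); rewrite sy.
    by apply: contraNneq ix => e; apply/eqP/(@perm_inj _ s); rewrite sx.
  have snxy i : ((s i == x) || (s i == y)) = ((i == x) || (i == y)).
    by rewrite -{1}sy -{2}sx !(inj_eq perm_inj) orbC.
  exists (f x, (f', s')); last first.
    congr (_, _); last by rewrite -mulgA tperm2 mulg1.
    apply/ffunP => i; rewrite !ffunE /=; case: ifP => [/orP[/eqP ->|/eqP ->]|->] //.
    by rewrite -sx fs.
  rewrite finset.in_setX /= fK //=; apply/colouredP; split=> i.
  - by rewrite !s'E; case E: ((i == x) || (i == y)); rewrite ?E // snxy E ss.
  - by rewrite !ffunE s'E; case E: ((i == x) || (i == y)); rewrite ?E // snxy E fs.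
  - by rewrite !inE ffunE => /and3P[/negPf -> /negPf -> /fK].
  - rewrite !inE s'E ffunE; case: (i == x) => //=; case: (i == y) => //= iD.
    exact: out.
move=> [[k [f' s']]]; rewrite finset.in_setX /= => /andP[kK /colouredP[ss fs fK out]] [-> ->].
have [s'x _] : s' x = x /\ f' x = v0 by apply: out; rewrite !inE eqxx andbF.
have [s'y _] : s' y = y /\ f' y = v0 by apply: out; rewrite !inE eqxx.
have s'xy i : ((s' i == x) || (s' i == y)) = ((i == x) || (i == y)).
  have q w : s' w = w -> (s' i == w) = (i == w).
    by move=> ew; rewrite -{1}ew (inj_eq (@perm_inj _ s')).
  by rewrite !q.
rewrite inE /= sE // eqxx eqxx andbT; apply/colouredP; split=> i.
- rewrite !sE //; case: (eqVneq i x) => [->|ix].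
    by case: (eqVneq y x) => [->//|]; rewrite eqxx.
  case: (eqVneq i y) => [->|iy]; first by rewrite eqxx.
  have := s'xy i; rewrite (negPf ix) (negPf iy) => /negbT; rewrite negb_or.
  by case/andP => /negPf -> /negPf ->; rewrite ss.
- rewrite !ffunE sE //; case: (eqVneq i x) => [->|ix] /=; first by rewrite eqxx orbT.
  case: (eqVneq i y) => [_|iy] /=; first by rewrite eqxx.
  by rewrite s'xy (negPf ix) (negPf iy) /= fs.
- rewrite ffunE; case: (eqVneq i x) => //= ix; case: (eqVneq i y) => //= iy iD.
  by apply: fK; rewrite !inE ix iy.
move=> iD; have ix : i != x by apply: contraNneq iD => ->.
have iy : i != y by apply: contraNneq iD => ->.
rewrite sE // ffunE (negPf ix) (negPf iy) /=; apply: out.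
by rewrite !inE (negPf iD) !andbF.
Qed.

(** Sorting by y = s x for a chosen x: y = x leaves |D| - 1 points and every other y leaves |D| - 2,
    which is the recurrence for H. *)
Lemma card_coloured D : #|coloured D|%:R = (Hpoly #|D|).[#|K|%:R] :> rat.
Proof.
have [m] := ubnP #|D|; elim: m D => // m IH D; rewrite ltnS => Dm.
have [->|[x xD]] := set_0Vmem D.
  rewrite cards0 Hpoly0 hornerC (_ : coloured _ = [set ([ffun=> v0], 1%g)]) ?cards1 //.
  apply/setP => -[f s]; rewrite finset.in_set1; apply/colouredP/eqP => [[_ _ _ out]|[-> ->]].
    congr (_, _); first by apply/ffunP => i; rewrite ffunE (out i _).2 ?inE.
    by apply/permP => i; rewrite perm1 (out i _).1 ?inE.
  by split=> i; rewrite ?perm1 ?ffunE ?inE.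
have cD : #|D| = #|D :\ x|.+1 by rewrite (cardsD1 x) xD.
have -> : #|coloured D| = (\sum_(y in D) #|[set p in coloured D | p.2 x == y]|)%N.
  rewrite -sum1_card (partition_big (fun p : {ffun T -> V} * {perm T} => p.2 x) (mem D)) /=.
    apply: eq_bigr => y _; rewrite -sum1_card; apply: eq_bigl => p.
    by rewrite !inE.
  move=> [f s] /colouredP[ss _ _ out] /=; apply: contraT => sxD.
  have [e _] := out _ sxD; move: e; rewrite ss => e.
  by rewrite -e xD in sxD.
rewrite (eq_bigr (fun y => #|K| * #|coloured (D :\ x :\ y)|)%N); last first.
  by move=> y yD; rewrite card_coloured_fiber.
rewrite (big_setD1 x) //= -big_distrr /= -mulnDr natrM natrD cD HpolyS hornerM hornerX.
congr (_ * _); rewrite hornerD; congr (_ + _).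
  have -> : D :\ x :\ x = D :\ x.
    by apply/setP => i; rewrite !inE; case: (i == x).
  by apply: IH; rewrite -cD.
rewrite [RHS]hornerZ natr_sum (eq_bigr (fun=> (Hpoly #|D :\ x|.-1).[#|K|%:R])).
  by rewrite sumr_const mulr_natl.
move=> y yD; have cDy : #|D :\ x| = #|D :\ x :\ y|.+1 by rewrite (cardsD1 y) yD.
by rewrite IH ?cDy //; move: Dm; rewrite cD cDy => /ltnW.
Qed.
End CountColoured.

(** * Möbius inversion on subsets *)

Section InclusionExclusion.
Variable T : finType.
Implicit Types (A J K : {set T}).

Lemma sum_subsets J (F : nat -> rat) :
  \sum_(K : {set T} | K \subset J) F #|K| = \sum_(r < #|J|.+1) F r * 'C(#|J|, r)%:R.
Proof.
rewrite (partition_big (fun K : {set T} => inord #|K| : 'I_#|J|.+1) xpredT) //=.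
apply: eq_bigr => r _; rewrite -cards_draws -[X in _ = _ * X%:R]sum1_card natr_sum mulr_sumr.
rewrite (eq_bigl (fun K : {set T} => K \in [set A : {set T} | A \subset J & #|A| == r])) /=; last first.
  move=> K; rewrite inE; apply: andb_id2l => KJ; rewrite -val_eqE /= inordK //.
  by rewrite ltnS subset_leq_card.
by apply: eq_bigr => K; rewrite inE => /andP[_ /eqP ->]; rewrite mulr1.
Qed.

(** For A inside J, writing K as A together with L gives an alternating sum over the subsets L of J
    \ A, that is, 0 to the power |J \ A|. *)
Lemma mobius_subsets A J :
  \sum_(K : {set T} | (K \subset J) && (A \subset K)) (-1) ^+ (#|J| - #|K|)
  = (A == J)%:R :> rat.
Proof.
have [AJ|nAJ] := boolP (A \subset J); last first.
  rewrite big1 => [|K /andP[KJ AK]]; last by rewrite (fintype.subset_trans AK KJ) in nAJ.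
  by case: (eqVneq A J) nAJ => // ->; rewrite fintype.subxx.
rewrite (reindex_onto (fun L => A :|: L) (fun K => K :\: A)) /=; last first.
  move=> K /andP[_ AK]; apply/setP => i; rewrite !inE; case: (boolP (i \in A)) => //= iA.
  by rewrite (fintype.subsetP AK).
rewrite (eq_big (fun L : {set T} => L \subset J :\: A)
  (fun L : {set T} => (-1) ^+ (#|J :\: A| - #|L|) : rat)).
- rewrite (sum_subsets _ (fun r => (-1) ^+ (#|J :\: A| - r))).
  have := exprDn (-1 : rat) 1 #|J :\: A|.
  rewrite addNr => E; transitivity ((0 : rat) ^+ #|J :\: A|).
    by rewrite E; apply: eq_bigr => r _; rewrite expr1n mulr1 mulr_natr.
  by rewrite expr0n cards_eq0 finset.setD_eq0 finset.eqEsubset AJ.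
- move=> L; apply/andP/idP => [[/andP[LJ _] /eqP e]|LJA].
    apply/fintype.subsetP => i iL; rewrite inE (fintype.subsetP LJ) ?inE ?iL ?orbT // andbT.
    by move: iL; rewrite -e !inE => /andP[].
  have [LJ LA] : L \subset J /\ [disjoint L & A] by move: LJA; rewrite finset.subsetD => /andP[].
  split; first by rewrite finset.subUset AJ LJ finset.subsetUl.
  apply/eqP/setP => i; rewrite !inE; case: (boolP (i \in A)) => //= iA.
  by rewrite (disjointFl LA iA).
move=> L /andP[/andP[LJ _] /eqP e].
have dLA : A :&: L = finset.set0.
  by apply/setP => i; rewrite -e !inE; case: (i \in A).
congr (_ ^+ _); rewrite cardsU dLA cards0 subn0 cardsD.
have -> : J :&: A = A by apply/finset.setIidPr.
by rewrite subnDA.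
Qed.
End InclusionExclusion.

Section NormalData.
Variables (n : nat) (n0 : (0 < n)%N).

Definition normal_data := [set p : {ffun 'I_n -> 'I_n} * 'S_n |
  [forall i, p.2 (p.2 i) == i] && [forall i, p.1 (p.2 i) == p.1 i] &&
  [forall i, forall v : 'I_n, (v < p.1 i)%N ==> [exists j, p.1 j == v]]].

Let below (j : nat) : {set 'I_n} := [set v : 'I_n | (v < j)%N].

Lemma card_below j : (j <= n)%N -> #|below j| = j.
Proof.
move=> jn; rewrite -sum1_card (eq_bigl (fun v : 'I_n => (v < j)%N)).
  by rewrite -(big_ord_widen n (fun=> 1%N) jn) sum1_card card_ord.
by move=> v; rewrite inE.
Qed.

(** A downward closed set containing x contains the x + 1 values up to x, so x < |A|. *)
Lemma initial_below (A : {set 'I_n}) :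
  [forall x in A, forall v : 'I_n, (v < x)%N ==> (v \in A)] = (A == below #|A|).
Proof.
apply/forall_inP/eqP => [H|e x xA].
  have cA : (#|A| <= n)%N by rewrite -[X in (_ <= X)%N]card_ord max_card.
  apply/eqP; rewrite eqEcard card_below // leqnn andbT.
  apply/fintype.subsetP => x xA; rewrite inE -(@card_below x.+1) //.
  apply/subset_leq_card/fintype.subsetP => v; rewrite inE ltnS leq_eqVlt.
  by case/orP => [/eqP/val_inj ->//|vx]; apply: (implyP (forallP (H x xA) v)).
apply/forallP => v; apply/implyP => vx; move: xA; rewrite e !inE.
exact: ltn_trans vx.
Qed.

(** Only j = |A| contributes; with j fixed in each term, Möbius inversion applies to the
    indicator. *)
Lemma initial_sum (A : {set 'I_n}) : (0 < #|A|)%N ->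
  (A == below #|A|)%:R = \sum_(1 <= j < n.+1) (A == below j)%:R :> rat.
Proof.
move=> A0; have cA : (#|A| <= n)%N by rewrite -[X in (_ <= X)%N]card_ord max_card.
rewrite (big_rem #|A|) /=; last by rewrite mem_index_iota A0.
rewrite big_seq big1 ?addr0 // => j.
rewrite mem_rem_uniq ?iota_uniq // inE mem_index_iota => /and3P[jA j1 jn].
case: eqP => // e; case/eqP: jA; rewrite [RHS](congr1 (fun B : {set _} => #|B|) e).
by rewrite card_below.
Qed.

Lemma card_invariant (K : {set 'I_n}) :
  \sum_(p : {ffun 'I_n -> 'I_n} * 'S_n | [forall i, p.2 (p.2 i) == i] &&
     [forall i, p.1 (p.2 i) == p.1 i] && (p.1 @: [set: 'I_n] \subset K)) 1
  = (Hpoly n).[#|K|%:R] :> rat.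
Proof.
pose v0 := Ordinal n0; rewrite -[n in Hpoly n]card_ord -cardsT.
rewrite -(card_coloured v0) -sum1_card natr_sum; apply: eq_bigl => p.
rewrite !inE; congr (_ && _); apply/fintype.subsetP/forallP => [H i|H x /imsetP[i _ ->]].
  by rewrite inE H // imset_f.
by have := H i; rewrite inE.
Qed.

Lemma card_normal_data : #|normal_data|%:R =
  \sum_(1 <= r < n.+1) coef_a n r * (Hpoly n).[r%:R] :> rat.
Proof.
pose Q (p : {ffun 'I_n -> 'I_n} * 'S_n) :=
  [forall i, p.2 (p.2 i) == i] && [forall i, p.1 (p.2 i) == p.1 i].
pose Im (p : {ffun 'I_n -> 'I_n} * 'S_n) := p.1 @: [set: 'I_n].
have ImE (p : {ffun 'I_n -> 'I_n} * 'S_n) :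
  [forall i, forall v : 'I_n, (v < p.1 i)%N ==> [exists j, p.1 j == v]] =
    (Im p == below #|Im p|).
  rewrite -initial_below; apply/forallP/forall_inP => [H x /imsetP[i _ ->]|H i].
    apply/forallP => v; apply/implyP => vi.
    have /existsP[j /eqP <-] := implyP (forallP (H i) v) vi.
    by rewrite imset_f.
  apply/forallP => v; apply/implyP => vi.
  have := implyP (forallP (H (p.1 i) (imset_f _ (finset.in_setT i))) v) vi.
  by case/imsetP => j _ ->; apply/existsP; exists j.
have Im0 p : (0 < #|Im p|)%N.
  by apply/card_gt0P; exists (p.1 (Ordinal n0)); rewrite imset_f.
have step1 : #|normal_data|%:R = \sum_(p | Q p) \sum_(1 <= j < n.+1) (Im p == below j)%:R :> rat.
  rewrite -sum1_card natr_sum (eq_bigl (fun p => Q p && (Im p == below #|Im p|))).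
    by rewrite big_mkcondr; apply: eq_bigr => p _; rewrite -initial_sum //; case: eqP.
  by move=> p; rewrite inE ImE.
pose h r := (Hpoly n).[r%:R] : rat.
(* Inclusion-exclusion produces a term for the empty set of colours, absent from the formula; it is
   zero as y divides H_n for n > 0. *)
have h0 : h 0%N = 0 by rewrite /h -(prednK n0) HpolyS hornerM hornerX mul0r.
(* Letting r run to n for every j allows the two sums to be exchanged; the binomial coefficient
   vanishes for r > j. *)
have step2 : #|normal_data|%:R =
    \sum_(1 <= j < n.+1) \sum_(0 <= r < n.+1) (-1) ^+ (j - r) * h r * 'C(j, r)%:R.
  rewrite step1 exchange_big /= !big_seq; apply: eq_bigr => j.
  rewrite mem_index_iota => /andP[j1 jn].
  have cj : #|below j| = j by rewrite card_below.
  transitivity (\sum_(K : {set 'I_n} | K \subset below j) (-1) ^+ (j - #|K|) * h #|K|).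
    under eq_bigr => p _ do rewrite -mobius_subsets cj.
    rewrite (exchange_big_dep (fun K : {set 'I_n} => K \subset below j)) /=; last by move=> p K _ /andP[].
    apply: eq_bigr => K KJ; rewrite /h -card_invariant mulr_sumr.
    apply: eq_big => [p|p _]; last by rewrite mulr1.
    by rewrite KJ.
  rewrite (sum_subsets _ (fun r => (-1) ^+ (j - r) * h r)) cj.
  rewrite [RHS](big_cat_nat (n := j.+1)) //= [X in _ = _ + X]big_nat.
  rewrite [X in _ = _ + X]big1 ?addr0 ?big_mkord //.
  by move=> r /andP[jr _]; rewrite bin_small ?mulr0.
rewrite step2 exchange_big /= big_ltn // big1 ?add0r; last first.
  by move=> j _; rewrite h0 mulr0 mul0r.
rewrite !big_seq; apply: eq_bigr => r; rewrite mem_index_iota => /andP[r1 rn].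
rewrite (big_cat_nat (n := r)) //=; last exact: ltnW.
rewrite big_nat big1 ?add0r; last first.
  by move=> j /andP[_ jr]; rewrite bin_small // mulr0.
(* The substitution j = r + i identifies the inner sum with a_(n,r). *)
rewrite /coef_a -{1}[r]add0n big_addn subSn // mulr_suml.
apply: eq_bigr => i _; rewrite addnK mulrAC; congr (_ * _ * _).
by rewrite addnC.
Qed.
End NormalData.

(** * Bijection between orbits and normal data *)

Section OrbitCount.
Variables (C : numClosedFieldType) (n : nat) (n0 : (0 < n)%N).

Lemma normal_dataP (f : {ffun 'I_n -> 'I_n}) (s : 'S_n) :
  reflect [/\ initial_levels (fun i => f i : nat), forall i, s (s i) = i
             & forall i, f (s i) = f i :> nat] ((f, s) \in normal_data n).
Proof.
rewrite inE /=; apply: (iffP andP) => [[/andP[/forallP h1 /forallP h2] /forallP h3]|[h1 h2 h3]].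
  split=> [i v vi||]; [|by move=> i; apply/eqP|by move=> i; rewrite (eqP (h2 i))].
  have vn : (v < n)%N by apply: ltn_trans vi _.
  have /existsP[j /eqP jv] := implyP (forallP (h3 i) (Ordinal vn)) vi.
  by exists j; rewrite jv.
split.
  by apply/andP; split; apply/forallP => i; apply/eqP; [rewrite h2|apply: val_inj; apply: h3].
apply/forallP => i; apply/forallP => v; apply/implyP => /h1[j jv].
by apply/existsP; exists j; apply/eqP/val_inj.
Qed.

Lemma card_borel_orbits : (borel_orbits C n #= `I_#|normal_data n|)%card.
Proof.
pose dat (k : 'I_#|normal_data n|) := enum_val k.
have datP k : [/\ initial_levels (fun i => (dat k).1 i : nat),
   forall i, (dat k).2 ((dat k).2 i) = i
   & forall i, (dat k).1 ((dat k).2 i) = (dat k).1 i :> nat].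
  by apply/normal_dataP; rewrite -surjective_pairing; apply: enum_valP.
pose vec k (i : 'I_n.-1) : 'M[C]_(ext_dim i.+1 n) :=
  lead i.+1 (fun i => (dat k).1 i : nat) (perm_mx (dat k).2).
have ex k : exists y : ambient C n, represents (vec k) y.
  have [dI ss fs] := datP k; apply: point_exists => i; rewrite /vec.
    exact: lead_perm_tr.
  exact: lead_perm_nonzero fs (ext_lt i).
have [pt ptE] := choice ex.
have -> : borel_orbits C n = [set borel_orbit (pt k) | k in [set: 'I_#|normal_data n|]]%classic.
  apply/seteqP; split => [O [x clx <-]|O [k _ <-]].
    have [f [s [y [fn fI ss fs [yE xy]]]]] := closure_normal n0 clx.
    pose f' : {ffun 'I_n -> 'I_n} := [ffun i => Ordinal (fn i)].
    have fE : (fun i => f' i : nat) = f by apply: funext => i; rewrite ffunE.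
    have fsn : (f', s) \in normal_data n.
      apply/normal_dataP; split=> //; first by rewrite fE.
      by move=> i; rewrite !ffunE /= fs.
    exists (enum_rank_in fsn (f', s)) => //.
    rewrite (borel_orbit_eq n0 xy); congr borel_orbit.
    apply: (ambient_eq (v := vec (enum_rank_in fsn (f', s)))); first exact: ptE.
    move=> i; rewrite yE /vec /dat enum_rankK_in //=.
    by rewrite fE.
  exists (pt k) => //; have [dI ss fs] := datP k.
  exact: (lead_point_closure ss fs (ptE k)).
apply: card_eq_trans (inj_card_eq _) _; last by rewrite card_eq_sym; apply: card_II.
move=> k1 k2 _ _ e.
have : borel_orbit (pt k1) (pt k2) by rewrite e; apply: borel_orbit_refl.
move=> /(borel_orbitP n0 (ptE k1) (ptE k2))[h [uh Uh hE]].
have [dI1 ss1 fs1] := datP k1; have [dI2 ss2 fs2] := datP k2.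
have [] := @wmin_recover n _ _ (dat k1).2 (dat k2).2 dI1 dI2 fs1 fs2.
  move=> k /andP[k0 kn] a b.
  have kn' : (k.-1 < n.-1)%N by lia.
  have kE : k = (Ordinal kn').+1 by rewrite /= prednK.
  move: a b; rewrite kE => a b.
  have [c c0 cE] := line_eqP (represents_neq0 (Ordinal kn') (ptE k2)) (hE (Ordinal kn')).
  exact: (lead_perm_support fs1 fs2 uh Uh c0 cE).
move=> ef es; apply: enum_val_inj; rewrite -/(dat k1) -/(dat k2).
rewrite [dat k1]surjective_pairing [dat k2]surjective_pairing es; congr (_, _).
by apply/ffunP => i; apply: val_inj; apply: ef.
Qed.
End OrbitCount.

Theorem theorem1p2 (R : realType) (n : nat) (hn : (1 <= n)%N) :
  exists b : nat,
    (borel_orbits R[i] n #= `I_b)%card /\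
    b%:R = \sum_(1 <= r < n.+1) coef_a n r * (Hpoly n).[r%:R] :> rat.
Proof.
exists #|normal_data n|; split; first exact: card_borel_orbits.
exact: card_normal_data.
Qed.
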